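(* Let $R$ be a commutative ring, $H$ a Hopf algebra over $R$, and $A$ an $H$-semiprime left $H$-module algebra. Let $Q_0=Q_0(A)$ be the right Martindale ring of quotients of $A$ formed with $H$-stable ideals, let $\widehat{A}$ be the self-injective hull of $A$ as an $M_H(A)$-module, and let $T=\mathrm{End}_{M_H(A)}(\widehat{A})$. Assume that $A$ is commutative, or $A$ is semiprime, or $H$ has a bijective antipode. Then $$\psi: T\to Z(Q_0)^H,\qquad f\mapsto [f: I_f\to A],\qquad I_f:=f^{-1}(A)\cap A,$$ is a ring isomorphism. Moreover, $Z(Q_0)^H$ is a von Neumann regular self-injective ring.
   Context: All rings are associative with unit. $H$ has comultiplication $\Delta(h)=\sum_{(h)}h_1\otimes h_2$, counit $\varepsilon$ and antipode $S$. A left $H$-module algebra is a unital $R$-algebra $A$ that is a left $H$-module with $h\cdot(ab)=\sum_{(h)}(h_1\cdot a)(h_2\cdot b)$ and $h\cdot 1_A=\varepsilon(h)1_A$. For a left $H$-module algebra $B$, $B^H=\{b\in B: h\cdot b=\varepsilon(h)b\ \forall h\in H\}$, $Z(B)$ is the center of $B$, and $Z(B)^H:=Z(B)\cap B^H$. An ideal (two-sided) of $A$ is $H$-stable if it is an $H$-submodule. $A$ is $H$-semiprime if it contains no non-zero nilpotent $H$-stable ideals; $A$ is semiprime if it contains no non-zero nilpotent ideals. $M_H(A)$ is the subring of $\mathrm{End}_R(A)$ generated by all left multiplications $L_a$ and right multiplications $R_a$ ($a\in A$) and all maps $L_h: x\mapsto h\cdot x$ ($h\in H$). $A$ is a left $M_H(A)$-module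 whose submodules are exactly the $H$-stable two-sided ideals of $A$. The self-injective hull $\widehat{M}$ of a module $M$ is the largest $M$-generated submodule of its injective hull $E(M)$, i.e. the sum of the images of all homomorphisms $M\to E(M)$; it contains $M$. Let $\mathcal{F}_H$ be the set of $H$-stable two-sided ideals of $A$ with zero left annihilator and zero right annihilator in $A$. Then $Q_0(A):=\varinjlim\{\mathrm{Hom}_{-A}(I,A)\mid I\in\mathcal{F}_H\}$ (right $A$-linear maps). Concretely, elements are classes $[f:I\to A]$ with $I\in\mathcal{F}_H$ and $f$ right $A$-linear, where $f:I\to A$ and $g:J\to A$ are equivalent if they agree on some $K\in\mathcal{F}_H$ with $K\subseteq I\cap J$; addition is $[f]+[g]=[f+g:I\cap J\to A]$ and multiplication is $[f][g]=[fg:JI\to A]$ with $fg$ the composition $a\mapsto f(g(a))$. $Q_0(A)$ is a left $H$-module algebra via $h\cdot[f:I\to A]=[h\cdot f:I\to A]$, $(h\cdot f)(x)=\sum_{(h)}h_1\cdot f(S(h_2)\cdot x)$ for $x\in I$. *)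

(* Defs.v *)
From HB Require Import structures.
From mathcomp Require Import all_boot all_order all_algebra.
From mathcomp Require Import all_classical.
Set Implicit Arguments.
Unset Strict Implicit.
Unset Printing Implicit Defensive.
Import GRing.Theory.
Local Open Scope ring_scope.
Local Open Scope quotient_scope.

Definition bilinear_map (R : pzRingType) (M N P : lmodType R)
    (f : M -> N -> P) : Prop :=
  (forall y, linear (f^~ y)) /\ (forall x, linear (f x)).

Definition trilinear_map (R : pzRingType) (M N L P : lmodType R)
    (f : M -> N -> L -> P) : Prop :=
  [/\ forall y z, linear (fun x => f x y z),
      forall x z, linear (fun y => f x y z)
    & forall x y, linear (fun z => f x y z)].

Section Tensor.
Variables (R : comPzRingType) (M N : lmodType R).

(* A formal sum of pure tensors is a list of pairs; tens_eq is the least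
   congruence of the monoid of formal sums making the pairing bilinear. *)
Inductive tens_eq : seq (M * N) -> seq (M * N) -> Prop :=
| tens_eq_refl s : tens_eq s s
| tens_eq_sym s t : tens_eq s t -> tens_eq t s
| tens_eq_trans s t u : tens_eq s t -> tens_eq t u -> tens_eq s u
| tens_eq_cat s s' t t' :
    tens_eq s s' -> tens_eq t t' -> tens_eq (s ++ t) (s' ++ t')
| tens_eq_catC s t : tens_eq (s ++ t) (t ++ s)
| tens_eq_0 y : tens_eq [:: (0, y)] [::]
| tens_eq_Dl x x' y : tens_eq [:: (x + x', y)] [:: (x, y); (x', y)]
| tens_eq_Dr x y y' : tens_eq [:: (x, y + y')] [:: (x, y); (x, y')]
| tens_eq_Z a x y : tens_eq [:: (a *: x, y)] [:: (x, a *: y)].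

Definition tens_eqb (s t : seq (M * N)) : bool := `[< tens_eq s t >].

Lemma tens_eqb_refl : reflexive tens_eqb.
Proof. by move=> s; apply/asboolP; apply: tens_eq_refl. Qed.
Lemma tens_eqb_sym : symmetric tens_eqb.
Proof. by move=> s t; apply/asboolP/asboolP; apply: tens_eq_sym. Qed.
Lemma tens_eqb_trans : transitive tens_eqb.
Proof.
move=> t s u /asboolP h1 /asboolP h2; apply/asboolP; exact: tens_eq_trans h1 h2.
Qed.
Canonical tens_equiv := EquivRel tens_eqb tens_eqb_refl tens_eqb_sym tens_eqb_trans.

Definition tensor := {eq_quot tens_equiv}.
HB.instance Definition _ := Choice.on tensor.
HB.instance Definition _ := EqQuotient.on tensor.

Definition tcl (s : seq (M * N)) : tensor := \pi_tensor s.
Definition tens (x : M) (y : N) : tensor := tcl [:: (x, y)].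

Lemma tclP s t : tens_eq s t <-> tcl s = tcl t.
Proof.
split=> [h|/eqmodP h]; first by apply/eqmodP; apply/asboolP.
by move: h; rewrite /= /tens_eqb => /asboolP.
Qed.

Lemma repr_tcl s : tens_eq (repr (tcl s)) s.
Proof. by apply/tclP; rewrite /tcl reprK. Qed.

Lemma tcl_repr t : tcl (repr t) = t. Proof. exact: reprK. Qed.

Definition tadd (t u : tensor) : tensor := tcl (repr t ++ repr u).
Definition tscale (a : R) (t : tensor) : tensor :=
  tcl [seq (a *: p.1, p.2) | p <- repr t].
Definition topp (t : tensor) : tensor := tscale (-1) t.
Definition tzero : tensor := tcl [::].

Lemma tadd_tcl s t : tadd (tcl s) (tcl t) = tcl (s ++ t).
Proof. by apply/tclP; apply: tens_eq_cat; apply: repr_tcl. Qed.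

Lemma tens_eq_scale a s t : tens_eq s t ->
  tens_eq [seq (a *: p.1, p.2) | p <- s] [seq (a *: p.1, p.2) | p <- t].
Proof.
elim=> {s t} /=.
- by move=> s; apply: tens_eq_refl.
- by move=> s t _; apply: tens_eq_sym.
- by move=> s t u _ h1 _ h2; apply: tens_eq_trans h1 h2.
- by move=> s s' t t' _ h1 _ h2; rewrite !map_cat; apply: tens_eq_cat.
- by move=> s t; rewrite !map_cat; apply: tens_eq_catC.
- by move=> y; rewrite scaler0; apply: tens_eq_0.
- by move=> x x' y; rewrite scalerDr; apply: tens_eq_Dl.
- by move=> x y y'; apply: tens_eq_Dr.
- move=> b x y; rewrite scalerA mulrC -scalerA; exact: tens_eq_Z.
Qed.

Lemma tscale_tcl a s : tscale a (tcl s) = tcl [seq (a *: p.1, p.2) | p <- s].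
Proof. by apply/tclP; apply: tens_eq_scale; apply: repr_tcl. Qed.

Lemma taddA : associative tadd.
Proof.
move=> t u v; rewrite -[t]tcl_repr -[u]tcl_repr -[v]tcl_repr.
by rewrite !tadd_tcl catA.
Qed.

Lemma taddC : commutative tadd.
Proof. by move=> t u; apply/tclP; apply: tens_eq_catC. Qed.

Lemma tadd0 : left_id tzero tadd.
Proof.
by move=> t; rewrite -{2}[t]tcl_repr /tzero -[t in LHS]tcl_repr tadd_tcl.
Qed.

Lemma tens_eq_cons p s t : tens_eq s t -> tens_eq (p :: s) (p :: t).
Proof. exact: (tens_eq_cat (tens_eq_refl [:: p])). Qed.

Lemma taddN : left_inverse tzero topp tadd.
Proof.
move=> t; rewrite -[t]tcl_repr /topp tscale_tcl tadd_tcl; apply/tclP.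
elim: (repr t) => [|[x y] s IH] /=; first exact: tens_eq_refl.
apply: (@tens_eq_trans _ ([:: (-1 *: x, y); (x, y)] ++
   ([seq (-1 *: p.1, p.2) | p <- s] ++ s))).
  rewrite /=; apply: tens_eq_cons.
  rewrite -(cat1s (x, y) s) -(cat1s (x, y) (_ ++ _)) !catA.
  by apply: tens_eq_cat; [exact: tens_eq_catC | exact: tens_eq_refl].
rewrite -[X in tens_eq _ X]cats0; apply: tens_eq_cat => //.
apply: tens_eq_trans (tens_eq_0 y).
apply: tens_eq_sym; rewrite -[0](addNr x) -scaleN1r; exact: tens_eq_Dl.
Qed.

HB.instance Definition _ := GRing.isZmodule.Build tensor taddA taddC tadd0 taddN.

Lemma tscaleA a b t : tscale a (tscale b t) = tscale (a * b) t.
Proof.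
rewrite -[t]tcl_repr !tscale_tcl -map_comp; congr tcl; apply: eq_map => p /=.
by rewrite scalerA.
Qed.
Lemma tscale1 : left_id 1 tscale.
Proof.
move=> t; rewrite -[t]tcl_repr tscale_tcl; congr tcl.
by rewrite -[RHS]map_id; apply: eq_map => -[x y] /=; rewrite scale1r.
Qed.
Lemma tscaleDr : right_distributive tscale +%R.
Proof.
move=> a t u; rewrite -[t]tcl_repr -[u]tcl_repr -[_ + _]/(tadd _ _) tadd_tcl.
by rewrite !tscale_tcl -[RHS]/(tadd _ _) tadd_tcl map_cat.
Qed.
Lemma tscaleDl t : {morph tscale^~ t : a b / a + b}.
Proof.
move=> a b; rewrite -[t]tcl_repr !tscale_tcl -[RHS]/(tadd _ _) tadd_tcl.
apply/tclP; elim: (repr t) => [|[x y] s IH] /=; first exact: tens_eq_refl.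
set s1 := map _ s in IH *; set s2 := map _ s in IH *; set s3 := map _ s in IH *.
apply: (@tens_eq_trans _ ([:: (a *: x, y); (b *: x, y)] ++ (s2 ++ s3))).
  rewrite -cat1s; apply: tens_eq_cat => //; rewrite scalerDl; exact: tens_eq_Dl.
rewrite /=; apply: tens_eq_cons.
rewrite -(cat1s _ s3) -cat1s !catA.
by apply: tens_eq_cat; [exact: tens_eq_catC | exact: tens_eq_refl].
Qed.

HB.instance Definition _ := GRing.Zmodule_isLmodule.Build R tensor
  tscaleA tscale1 tscaleDr tscaleDl.

(* The sum of the f x y over a representative sum of pure tensors x (x) y of t.
   It is meant for bilinear f, for which the representative is irrelevant. *)
Definition tsum (P : zmodType) (t : tensor) (f : M -> N -> P) : P :=
  \sum_(p <- repr t) f p.1 p.2.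

Section Lift.
Variables (P : lmodType R) (f : M -> N -> P).
Hypothesis bf : bilinear_map f.

Lemma bilinDl x x' y : f (x + x') y = f x y + f x' y.
Proof. by have := bf.1 y 1 x x'; rewrite !scale1r. Qed.
Lemma bilinDr x y y' : f x (y + y') = f x y + f x y'.
Proof. by have := bf.2 x 1 y y'; rewrite !scale1r. Qed.
Lemma bilin0l y : f 0 y = 0.
Proof. by apply: (addIr (f 0 y)); rewrite -bilinDl !add0r. Qed.
Lemma bilin0r x : f x 0 = 0.
Proof. by apply: (addIr (f x 0)); rewrite -bilinDr !add0r. Qed.
Lemma bilinZl a x y : f (a *: x) y = a *: f x y.
Proof. by have := bf.1 y a x 0; rewrite bilin0l !addr0. Qed.
Lemma bilinZr a x y : f x (a *: y) = a *: f x y.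
Proof. by have := bf.2 x a y 0; rewrite bilin0r !addr0. Qed.

Lemma tens_eq_sum s t : tens_eq s t ->
  \sum_(p <- s) f p.1 p.2 = \sum_(p <- t) f p.1 p.2.
Proof.
elim=> {s t} //.
- by move=> s t u _ -> _ ->.
- by move=> s s' t t' _ h1 _ h2; rewrite !big_cat /= h1 h2.
- by move=> s t; rewrite !big_cat /= addrC.
- by move=> y; rewrite big_seq1 big_nil /= bilin0l.
- by move=> x x' y; rewrite !big_cons !big_nil /= !addr0 bilinDl.
- by move=> x x' y; rewrite !big_cons !big_nil /= !addr0 bilinDr.
- by move=> a x y; rewrite !big_seq1 /= bilinZl bilinZr.
Qed.

Lemma tsum_tcl s : tsum (tcl s) f = \sum_(p <- s) f p.1 p.2.
Proof. by apply: tens_eq_sum; apply: repr_tcl. Qed.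

Lemma tsum_tens x y : tsum (tens x y) f = f x y.
Proof. by rewrite tsum_tcl big_seq1. Qed.

Lemma tsum_linear : linear (fun t => tsum t f).
Proof.
move=> a t u; rewrite -[t]tcl_repr -[u]tcl_repr.
rewrite -[_ *: _]/(tscale _ _) -[_ + _ in LHS]/(tadd _ _) tscale_tcl tadd_tcl.
rewrite !tsum_tcl big_cat big_map /= scaler_sumr; congr (_ + _).
by apply: eq_bigr => p _; rewrite bilinZl.
Qed.
End Lift.

Lemma tens_bilinear : bilinear_map tens.
Proof.
have ZE a x y : tens (a *: x) y = a *: tens x y.
  by rewrite -[RHS]/(tscale _ _) tscale_tcl.
split=> [y a x x'|x a y y'].
  rewrite -ZE -[RHS]/(tadd _ _) tadd_tcl; apply/tclP; exact: tens_eq_Dl.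
rewrite -ZE -[RHS]/(tadd _ _) tadd_tcl; apply/tclP.
apply: tens_eq_trans (tens_eq_Dr _ _ _) _.
rewrite -[X in tens_eq X _]cat1s; apply: tens_eq_cat; last exact: tens_eq_refl.
exact/tens_eq_sym/tens_eq_Z.
Qed.

Lemma tsum_of_tens (t : tensor) : tsum t tens = t.
Proof.
rewrite -[RHS]tcl_repr /tsum; elim: (repr t) => [|[x y] s IH] /=.
  by rewrite big_nil.
by rewrite big_cons IH -[LHS]/(tadd _ _) tadd_tcl.
Qed.

End Tensor.

Arguments tens {R M N} x y.
Arguments tsum {R M N P} t f.

(* Unital associative algebras over R; MathComp's algType would exclude the
   zero algebra. *)
Record pzAlg (R : comPzRingType) := PzAlg {
  pzalg_ring : pzRingType;
  pzalg_scale : R -> pzalg_ring -> pzalg_ring;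
  pzalg_scaleA : forall k l x,
    pzalg_scale k (pzalg_scale l x) = pzalg_scale (k * l) x;
  pzalg_scale1 : left_id 1 pzalg_scale;
  pzalg_scaleDr : right_distributive pzalg_scale +%R;
  pzalg_scaleDl : forall x, {morph pzalg_scale^~ x : k l / k + l};
  pzalg_scaleAl : forall k x y, pzalg_scale k (x * y) = pzalg_scale k x * y;
  pzalg_scaleAr : forall k x y, pzalg_scale k (x * y) = x * pzalg_scale k y
}.

Definition pzalg_sort (R : comPzRingType) (A : pzAlg R) : Type := pzalg_ring A.
Coercion pzalg_sort : pzAlg >-> Sortclass.
HB.instance Definition _ (R : comPzRingType) (A : pzAlg R) :=
  GRing.PzRing.on (pzalg_sort A).
HB.instance Definition _ (R : comPzRingType) (A : pzAlg R) :=
  GRing.Zmodule_isLmodule.Build R (pzalg_sort A)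
    (@pzalg_scaleA R A) (@pzalg_scale1 R A) (@pzalg_scaleDr R A)
    (@pzalg_scaleDl R A).

Lemma pzscalerAl (R : comPzRingType) (A : pzAlg R) (k : R) (x y : A) :
  k *: (x * y) = (k *: x) * y.
Proof. exact: pzalg_scaleAl. Qed.
Lemma pzscalerAr (R : comPzRingType) (A : pzAlg R) (k : R) (x y : A) :
  k *: (x * y) = x * (k *: y).
Proof. exact: pzalg_scaleAr. Qed.

(* Sweedler's notation: tsum (comul h) (fun h1 h2 => F h1 h2) is the sum over
   (h) of F h1 h2. *)
Record hopfAlg (R : comPzRingType) := HopfAlg {
  hopf_alg :> pzAlg R;
  comul : hopf_alg -> tensor hopf_alg hopf_alg;
  counit : hopf_alg -> R;
  antipode : hopf_alg -> hopf_alg;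
  comul_linear : linear comul;
  counit_linear : scalar counit;
  antipode_linear : linear antipode;
  comul1 : comul 1 = tens (1 : hopf_alg) (1 : hopf_alg);
  comulM : forall g h : hopf_alg, comul (g * h) =
    tsum (comul g) (fun g1 g2 =>
      tsum (comul h) (fun h1 h2 => tens (g1 * h1) (g2 * h2)));
  counit1 : counit 1 = 1;
  counitM : {morph counit : g h / g * h};
  comulA : forall h : hopf_alg,
    tsum (comul h) (fun h1 h2 =>
      tsum (comul h1) (fun h11 h12 => tens (tens h11 h12) h2)) =
    tsum (comul h) (fun h1 h2 =>
      tsum (comul h2) (fun h21 h22 => tens (tens h1 h21) h22));
  counitl : forall h : hopf_alg, tsum (comul h) (fun h1 h2 => counit h1 *: h2) = h;
  counitr : forall h : hopf_alg, tsum (comul h) (fun h1 h2 => counit h2 *: h1) = h;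
  antipodel : forall h : hopf_alg,
    tsum (comul h) (fun h1 h2 => antipode h1 * h2) = counit h *: (1 : hopf_alg);
  antipoder : forall h : hopf_alg,
    tsum (comul h) (fun h1 h2 => h1 * antipode h2) = counit h *: (1 : hopf_alg)
}.

Definition sw (R : comPzRingType) (H : hopfAlg R) (P : zmodType)
    (h : H) (f : H -> H -> P) : P := tsum (comul h) f.

Record hmodAlg (R : comPzRingType) (H : hopfAlg R) := HModAlg {
  hmod_alg :> pzAlg R;
  hact : H -> hmod_alg -> hmod_alg;
  hact_bilinear : bilinear_map hact;
  hact1 : forall x, hact 1 x = x;
  hactA : forall g h x, hact (g * h) x = hact g (hact h x);
  hactM : forall h x y,
    hact h (x * y) = sw h (fun h1 h2 => hact h1 x * hact h2 y);
  hact_one : forall h, hact h 1 = counit h *: (1 : hmod_alg)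
}.

Section Sweedler.
Variables (R : comPzRingType) (H : hopfAlg R).
Implicit Types (g h : H).

Lemma tsum_eq (M N : lmodType R) (P : zmodType) (t : tensor M N)
  (f g : M -> N -> P) : (forall x y, f x y = g x y) -> tsum t f = tsum t g.
Proof. by move=> e; apply: eq_bigr => p _; apply: e. Qed.

Lemma sw_eq (P : zmodType) h (f g : H -> H -> P) :
  (forall x y, f x y = g x y) -> sw h f = sw h g.
Proof. exact: tsum_eq. Qed.

Lemma sw_add (P : zmodType) h (f g : H -> H -> P) :
  sw h (fun x y => f x y + g x y) = sw h f + sw h g.
Proof. exact: big_split. Qed.

Lemma sw_scale (P : lmodType R) h a (f : H -> H -> P) :
  sw h (fun x y => a *: f x y) = a *: sw h f.
Proof. by rewrite /sw /tsum scaler_sumr. Qed.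

Lemma sw_mull (P : pzRingType) h a (f : H -> H -> P) :
  sw h (fun x y => a * f x y) = a * sw h f.
Proof. by rewrite /sw /tsum mulr_sumr. Qed.

Lemma sw_mulr (P : pzRingType) h a (f : H -> H -> P) :
  sw h (fun x y => f x y * a) = sw h f * a.
Proof. by rewrite /sw /tsum mulr_suml. Qed.

Lemma sw_exch (P : zmodType) g h (f : H -> H -> H -> H -> P) :
  sw g (fun g1 g2 => sw h (fun h1 h2 => f g1 g2 h1 h2)) =
  sw h (fun h1 h2 => sw g (fun g1 g2 => f g1 g2 h1 h2)).
Proof. exact: exchange_big. Qed.

Lemma sw_morph (P Q : zmodType) (k : P -> Q) h (f : H -> H -> P) :
  k 0 = 0 -> {morph k : x y / x + y} -> k (sw h f) = sw h (fun x y => k (f x y)).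
Proof. by move=> k0 kD; rewrite /sw /tsum (big_morph k kD k0). Qed.

Lemma sw_linear (P : lmodType R) (f : H -> H -> P) :
  bilinear_map f -> linear (fun h => sw h f).
Proof.
by move=> bf a g h; rewrite /sw comul_linear (tsum_linear bf).
Qed.

Lemma sw1 (P : lmodType R) (f : H -> H -> P) :
  bilinear_map f -> sw 1 f = f 1 1.
Proof. by move=> bf; rewrite /sw comul1 tsum_tens. Qed.

Lemma tsum_linP (M N P Q : lmodType R) (t : tensor M N) (k : P -> Q)
    (f : M -> N -> P) : linear k -> k (tsum t f) = tsum t (fun x y => k (f x y)).
Proof.
move=> kl; have kD : {morph k : x y / x + y}.
  by move=> x y; have := kl 1 x y; rewrite !scale1r.
have k0 : k 0 = 0 by apply: (addIr (k 0)); rewrite -kD !add0r.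
by rewrite /tsum (big_morph k kD k0).
Qed.

Lemma swM (P : lmodType R) g h (f : H -> H -> P) : bilinear_map f ->
  sw (g * h) f = sw g (fun g1 g2 => sw h (fun h1 h2 => f (g1 * h1) (g2 * h2))).
Proof.
move=> bf; rewrite /sw comulM (tsum_linP _ _ (tsum_linear bf)).
apply: tsum_eq => g1 g2; rewrite (tsum_linP _ _ (tsum_linear bf)).
by apply: tsum_eq => h1 h2; rewrite tsum_tens.
Qed.

Lemma swA (P : lmodType R) h (f : H -> H -> H -> P) : trilinear_map f ->
  sw h (fun a b => sw a (fun a1 a2 => f a1 a2 b)) =
  sw h (fun a b => sw b (fun b1 b2 => f a b1 b2)).
Proof.
move=> [f1 f2 f3].
pose k (t : tensor H H) (z : H) : P := tsum t (fun x y => f x y z).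
have bk z : bilinear_map (fun x y => f x y z) by split=> [y|x].
have Bk : bilinear_map k.
  split=> [z|t]; first exact: tsum_linear.
  move=> a x y; rewrite /k /tsum scaler_sumr -big_split /=.
  by apply: eq_bigr => p _; rewrite f3.
have := congr1 (fun t => tsum t k) (comulA h).
rewrite /= !(tsum_linP _ _ (tsum_linear Bk)) /sw => E.
transitivity (tsum (comul h) (fun x y => tsum (tsum (comul x)
   (fun h11 h12 => tens (tens h11 h12) y)) k)).
  apply: tsum_eq => a b; rewrite (tsum_linP _ _ (tsum_linear Bk)).
  by apply: tsum_eq => x y; rewrite (tsum_tens Bk) /k (tsum_tens (bk _)).
rewrite E; apply: tsum_eq => a b; rewrite (tsum_linP _ _ (tsum_linear Bk)).
by apply: tsum_eq => x y; rewrite (tsum_tens Bk) /k (tsum_tens (bk _)).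
Qed.

Lemma linD (M N : lmodType R) (k : M -> N) x y : linear k -> k (x + y) = k x + k y.
Proof. by move=> kl; have := kl 1 x y; rewrite !scale1r. Qed.
Lemma lin0 (M N : lmodType R) (k : M -> N) : linear k -> k 0 = 0.
Proof. by move=> kl; apply: (addIr (k 0)); rewrite -(linD _ _ kl) !add0r. Qed.
Lemma linZ (M N : lmodType R) (k : M -> N) a x : linear k -> k (a *: x) = a *: k x.
Proof. by move=> kl; have := kl a x 0; rewrite (lin0 kl) !addr0. Qed.

Lemma swl (P : lmodType R) h (k : H -> P) : linear k ->
  sw h (fun a b => counit a *: k b) = k h.
Proof.
move=> kl; rewrite -[in RHS](counitl h) (tsum_linP _ _ kl).
by apply: tsum_eq => x y; rewrite (linZ _ _ kl).
Qed.
Lemma swr (P : lmodType R) h (k : H -> P) : linear k ->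
  sw h (fun a b => counit b *: k a) = k h.
Proof.
move=> kl; rewrite -[in RHS](counitr h) (tsum_linP _ _ kl).
by apply: tsum_eq => x y; rewrite (linZ _ _ kl).
Qed.

Lemma mul_lin_l (A : pzAlg R) (a : A) : linear ( *%R a).
Proof. by move=> k x y; rewrite mulrDr pzscalerAr. Qed.
Lemma mul_lin_r (A : pzAlg R) (a : A) : linear (fun x : A => x * a).
Proof. by move=> k x y; rewrite mulrDl pzscalerAl. Qed.

Lemma lin_comp (M N P : lmodType R) (k : N -> P) (l : M -> N) :
  linear k -> linear l -> linear (fun x => k (l x)).
Proof. by move=> kl ll a x y; rewrite ll kl. Qed.

Lemma lin_scale (M N : lmodType R) (a : R) (k : M -> N) :
  linear k -> linear (fun x => a *: k x).
Proof. by move=> kl b x y; rewrite kl scalerDr !scalerA mulrC. Qed.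

Lemma lin_mull (M : lmodType R) (A : pzAlg R) (a : A) (k : M -> A) :
  linear k -> linear (fun x => a * k x).
Proof. by move=> kl b x y; rewrite kl mul_lin_l. Qed.
Lemma lin_mulr (M : lmodType R) (A : pzAlg R) (a : A) (k : M -> A) :
  linear k -> linear (fun x => k x * a).
Proof. by move=> kl b x y; rewrite kl mulrDl pzscalerAl. Qed.
Lemma lin_S (M : lmodType R) (k : M -> H) :
  linear k -> linear (fun x => antipode (k x)).
Proof. by move=> kl a x y; rewrite kl antipode_linear. Qed.
Lemma lin_id (M : lmodType R) : linear (fun x : M => x).
Proof. by []. Qed.
Lemma lin_epsl (M : lmodType R) (k : M -> H) (N : lmodType R) (y : N) :
  linear k -> linear (fun x => counit (k x) *: y).
Proof. by move=> kl a u v; rewrite kl counit_linear scalerDl scalerA. Qed.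
Lemma lin_actl (A : hmodAlg H) (M : lmodType R) (k : M -> H) (x : A) :
  linear k -> linear (fun m => hact (k m) x).
Proof.
by move=> kl a u v; rewrite kl ((hact_bilinear A).1 x).
Qed.
Lemma lin_actr (A : hmodAlg H) (M : lmodType R) (k : M -> A) h :
  linear k -> linear (fun m => hact h (k m)).
Proof.
by move=> kl a u v; rewrite kl (hact_bilinear A).2.
Qed.
Lemma lin_swr (M P : lmodType R) (f : M -> H -> H -> P) h :
  (forall x y, linear (fun m => f m x y)) -> linear (fun m => sw h (f m)).
Proof.
move=> fl a u v; rewrite -sw_scale -sw_add; apply: sw_eq => x y; exact: fl.
Qed.
Lemma lin_swl (M P : lmodType R) (k : M -> H) (f : H -> H -> P) :
  bilinear_map f -> linear k -> linear (fun m => sw (k m) f).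
Proof.
by move=> bf kl a u v; rewrite kl (sw_linear bf).
Qed.

End Sweedler.

Ltac lin_solve :=
  match goal with
  | |- bilinear_map _ => split=> ?; lin_solve
  | |- trilinear_map _ => split=> ? ?; lin_solve
  | _ => by []
  | _ => first [ exact: lin_id
               | apply: antipode_linear
               | apply: lin_mull; lin_solve
               | apply: lin_mulr; lin_solve
               | apply: lin_S; lin_solve
               | apply: lin_epsl; lin_solve
               | apply: lin_scale; lin_solve
               | apply: lin_actl; lin_solve
               | apply: lin_actr; lin_solve
               | apply: lin_swr => ? ?; lin_solve
               | apply: lin_swl; lin_solve ]
  end.

Section HopfTheory.
Variables (R : comPzRingType) (H : hopfAlg R).
Implicit Types (g h : H).

Lemma antipode1 : antipode (1 : H) = 1.
Proof.
have := @antipodel R H 1; rewrite counit1 scale1r -/(sw 1 _) sw1 ?mulr1 //.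
lin_solve.
Qed.

Lemma antipodeM g h : antipode (g * h) = antipode h * antipode g.
Proof.
pose X := sw g (fun g1 g2 => sw h (fun h1 h2 => antipode (g1 * h1) *
  sw g2 (fun g21 g22 => sw h2 (fun h21 h22 =>
     g21 * h21 * (antipode h22 * antipode g22))))).
transitivity X.
  have E g2 h2 : sw g2 (fun g21 g22 => sw h2 (fun h21 h22 =>
     g21 * h21 * (antipode h22 * antipode g22))) = counit h2 *: (counit g2 *: (1 : H)).
    rewrite -[X in _ = _ *: X](antipoder g2) -/(sw g2 _) -sw_scale.
    apply: sw_eq => a b.
    under sw_eq do rewrite mulrA -[a * _ * antipode _]mulrA.
    rewrite sw_mulr sw_mull [sw _ _]antipoder -pzscalerAr mulr1.
    by rewrite pzscalerAl.
  rewrite /X.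
  under sw_eq => g1 g2.
    under sw_eq => h1 h2 do
      rewrite E -!pzscalerAr mulr1 scalerA mulrC -scalerA.
    rewrite sw_scale.
    rewrite (swr h (k := fun h1 => antipode (g1 * h1))); last lin_solve.
    over.
  by rewrite (swr g (k := fun g1 => antipode (g1 * h))) //; lin_solve.
rewrite /X.
transitivity (sw g (fun g1 g2 => sw h (fun h1 h2 => sw g2 (fun g21 g22 =>
   sw h2 (fun h21 h22 => antipode (g1 * h1) *
     (g21 * h21 * (antipode h22 * antipode g22))))))).
  do 2![apply: sw_eq => ? ?]; rewrite -sw_mull; apply: sw_eq => ? ?.
  by rewrite sw_mull.
under sw_eq => g1 g2.
  under sw_eq => h1 h2 do rewrite sw_exch.
  rewrite -(swA h (f := fun h1 h21 h22 => sw g2 (fun g21 g22 =>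
     antipode (g1 * h1) * (g21 * h21 * (antipode h22 * antipode g22)))));
    last by lin_solve.
  under sw_eq => a b do rewrite -sw_exch.
  rewrite sw_exch.
  over.
rewrite -(swA g (f := fun g1 g21 g22 => sw h (fun a b => sw a (fun a1 a2 =>
     antipode (g1 * a1) * (g21 * a2 * (antipode b * antipode g22))))));
    last by lin_solve.
transitivity (sw g (fun a b => sw h (fun c d => counit a *: (counit c *:
   (antipode d * antipode b))))).
  apply: sw_eq => a b; rewrite sw_exch; apply: sw_eq => c d.
  have := antipodel (a * c); rewrite -/(sw _ _) swM; last lin_solve.
  rewrite counitM => E.
  under sw_eq do under sw_eq do rewrite mulrA.
  under sw_eq do rewrite sw_mulr.
  by rewrite sw_mulr E -pzscalerAl mul1r scalerA.
under sw_eq => a b.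
  rewrite sw_scale (swl h (k := fun d => antipode d * antipode b)); last lin_solve.
  over.
by rewrite (swl g (k := fun b => antipode h * antipode b)) //; lin_solve.
Qed.

Variable A : hmodAlg H.
Implicit Types (x y a : A).

Lemma hactDl g h x : hact (g + h) x = hact g x + hact h x.
Proof. exact: (bilinDl (hact_bilinear A)). Qed.
Lemma hactDr h x y : hact h (x + y) = hact h x + hact h y.
Proof. exact: (bilinDr (hact_bilinear A)). Qed.
Lemma hactZl r h x : hact (r *: h) x = r *: hact h x.
Proof. exact: (bilinZl (hact_bilinear A)). Qed.
Lemma hactZr r h x : hact h (r *: x) = r *: hact h x.
Proof. exact: (bilinZr (hact_bilinear A)). Qed.
Lemma hact0r h : hact h 0 = 0 :> A.
Proof. exact: (bilin0r (hact_bilinear A)). Qed.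

Lemma antipode_hactM h x a :
  hact (antipode h) (x * a) =
  sw h (fun h1 h2 => hact (antipode h2) x * hact (antipode h1) a).
Proof.
pose W k := sw k (fun u v => hact (antipode v) x * hact (antipode u) a).
have Wl : linear W by rewrite /W; lin_solve.
have Y k : sw k (fun k1 k2 => hact k1 (W k2)) = counit k *: (x * a).
  transitivity (sw k (fun k1 k2 => sw k1 (fun k11 k12 => sw k2 (fun u v =>
     hact (k11 * antipode v) x * hact (k12 * antipode u) a)))).
    apply: sw_eq => k1 k2; rewrite /W sw_exch.
    rewrite (sw_morph (k := hact k1)) ?hact0r //; last exact: hactDr.
    by apply: sw_eq => u v; rewrite hactM; apply: sw_eq => ? ?; rewrite !hactA.
  rewrite (swA k (f := fun k11 k12 k2 => sw k2 (fun u v =>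
     hact (k11 * antipode v) x * hact (k12 * antipode u) a))); last lin_solve.
  transitivity (sw k (fun k1 k2 => hact (k1 * antipode k2) x * a)).
    apply: sw_eq => k1 b.
    rewrite -(swA b (f := fun b1 u v =>
       hact (k1 * antipode v) x * hact (b1 * antipode u) a)); last lin_solve.
    transitivity (sw b (fun c v => counit c *: (hact (k1 * antipode v) x * a))).
      apply: sw_eq => c v; rewrite sw_mull; have := antipoder c.
      move=> /(congr1 (fun z => hact z a)).
      rewrite /= (tsum_linP _ _ (k := fun z : H => hact z a)); last lin_solve.
      by rewrite /sw => ->; rewrite hactZl hact1 pzscalerAr.
    by rewrite (swl b (k := fun v => hact (k1 * antipode v) x * a)) //; lin_solve.
  rewrite sw_mulr; have := antipoder k => /(congr1 (fun z => hact z x)).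
  rewrite /= (tsum_linP _ _ (k := fun z : H => hact z x)); last lin_solve.
  by rewrite /sw => ->; rewrite hactZl hact1 pzscalerAl.
rewrite -/(W h).
rewrite -(swr h (k := fun u => hact (antipode u) (x * a))); last lin_solve.
transitivity (sw h (fun h1 h2 => sw h2 (fun h21 h22 =>
   hact (antipode h1) (hact h21 (W h22))))).
  apply: sw_eq => h1 h2; rewrite -hactZr -Y.
  by rewrite (sw_morph (k := hact _)) ?hact0r //; exact: hactDr.
rewrite -(swA h (f := fun h1 h21 h22 => hact (antipode h1) (hact h21 (W h22))));
  last first.
  by split=> ? ?; [lin_solve|lin_solve|apply: lin_actr; apply: lin_actr].
rewrite -[RHS](swl h Wl); apply: sw_eq => c d.
have := antipodel c => /(congr1 (fun z => hact z (W d))).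
rewrite /= (tsum_linP _ _ (k := fun z : H => hact z (W d))); last lin_solve.
rewrite hactZl hact1 => <-; apply: sw_eq => u v; exact/esym/hactA.
Qed.

End HopfTheory.

Section CenterInvariants.
Variables (R : comPzRingType) (H : hopfAlg R) (B : hmodAlg H).

Definition invariant (b : B) : Prop := forall h : H, hact h b = counit h *: b.
Definition central (b : B) : Prop := forall c : B, b * c = c * b.

Definition center_inv : {pred B} := fun b => `[< central b /\ invariant b >].

Lemma center_inv_subring : subring_closed center_inv.
Proof.
split.
- by apply/asboolP; split=> [c|h]; rewrite ?mul1r ?mulr1 // hact_one.
- move=> x y /asboolP[cx ix] /asboolP[cy iy]; apply/asboolP; split=> [c|h].
    by rewrite mulrBl mulrBr cx cy.
  by rewrite hactDr ix -scaleN1r hactZr iy scalerDr !scalerA [_ * -1]mulrC.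
- move=> x y /asboolP[cx ix] /asboolP[cy iy]; apply/asboolP; split=> [c|h].
    by rewrite -mulrA cy mulrA cx mulrA.
  rewrite hactM.
  under sw_eq do rewrite ix iy -pzscalerAl -pzscalerAr.
  rewrite (swl h (k := fun b => counit b *: (x * y))) //; lin_solve.
Qed.

Record center_inv_ring := CenterInv {
  center_inv_val :> B; _ : center_inv_val \in center_inv }.
HB.instance Definition _ := [isSub for center_inv_val].
HB.instance Definition _ := [Choice of center_inv_ring by <:].
HB.instance Definition _ := 
  GRing.SubChoice_isSubPzRing.Build B center_inv center_inv_ring center_inv_subring.

End CenterInvariants.

Section Ideals.
Variables (R : comPzRingType) (H : hopfAlg R) (A : hmodAlg H).
Implicit Types (I J K : set A) (a b x y : A).

Definition is_ideal I : Prop :=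
  [/\ I 0, forall x y, I x -> I y -> I (x + y),
      forall a x, I x -> I (a * x) & forall a x, I x -> I (x * a)].

Definition h_stable I : Prop := forall (h : H) x, I x -> I (hact h x).

Definition ideal_prod I J : set A := fun x => exists s : seq (A * A),
  (forall p, p \in s -> I p.1 /\ J p.2) /\ x = \sum_(p <- s) p.1 * p.2.

Fixpoint ideal_pow I (n : nat) : set A :=
  if n is n'.+1 then ideal_prod I (ideal_pow I n') else setT.

Definition nilpotent_ideal I : Prop :=
  exists n, forall x, ideal_pow I n x -> x = 0.

Definition h_semiprime : Prop := forall I,
  is_ideal I -> h_stable I -> nilpotent_ideal I -> forall x, I x -> x = 0.

Definition semiprime : Prop := forall I,
  is_ideal I -> nilpotent_ideal I -> forall x, I x -> x = 0.

(* The annihilators are taken in A: left (x I = 0), then right (I x = 0). *)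
Definition FH I : Prop := [/\ is_ideal I, h_stable I,
  forall x, (forall y, I y -> x * y = 0) -> x = 0 &
  forall x, (forall y, I y -> y * x = 0) -> x = 0].

Definition right_linear_on I (f : A -> A) : Prop :=
  (forall x y, I x -> I y -> f (x + y) = f x + f y) /\
  (forall x a, I x -> f (x * a) = f x * a).

Lemma idealZ I r x : is_ideal I -> I x -> I (r *: x).
Proof. by case=> _ _ Il _ Ix; rewrite -[x]mul1r pzscalerAl; apply: Il. Qed.

Lemma ideal_sum I (T : eqType) (s : seq T) (F : T -> A) : is_ideal I ->
  (forall p, p \in s -> I (F p)) -> I (\sum_(p <- s) F p).
Proof.
case=> I0 ID _ _; elim: s => [|p s IH] h; first by rewrite big_nil.
rewrite big_cons; apply: ID; first by apply: h; rewrite inE eqxx.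
by apply: IH => q qs; apply: h; rewrite inE qs orbT.
Qed.

Lemma ideal_sw I h (F : H -> H -> A) : is_ideal I ->
  (forall u v, I (F u v)) -> I (sw h F).
Proof. by move=> Ii FI; apply: (ideal_sum (I := I)). Qed.

Lemma ideal_prod_mem I J x y : I x -> J y -> ideal_prod I J (x * y).
Proof.
move=> Ix Jy; exists [:: (x, y)]; rewrite big_seq1; split=> // p.
by rewrite inE => /eqP ->.
Qed.

Lemma ideal_prod_ideal I J : is_ideal I -> is_ideal J -> is_ideal (ideal_prod I J).
Proof.
move=> [I0 ID Il Ir] [J0 JD Jl Jr]; split.
- by exists [::]; rewrite big_nil.
- move=> x y [s [sP ->]] [t [tP ->]]; exists (s ++ t); rewrite big_cat; split=> // p.
  by rewrite mem_cat => /orP[/sP|/tP].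
- move=> a x [s [sP ->]]; exists [seq (a * p.1, p.2) | p <- s]; split.
    by move=> p /mapP[q /sP[? ?] ->] /=; split=> //; apply: Il.
  by rewrite big_map mulr_sumr; apply: eq_bigr => p _; rewrite mulrA.
- move=> a x [s [sP ->]]; exists [seq (p.1, p.2 * a) | p <- s]; split.
    by move=> p /mapP[q /sP[? ?] ->] /=; split=> //; apply: Jr.
  by rewrite big_map mulr_suml; apply: eq_bigr => p _; rewrite mulrA.
Qed.

Lemma ideal_prod_sub I J x : is_ideal I -> is_ideal J -> ideal_prod I J x -> I x /\ J x.
Proof.
move=> Ii Ji [s [sP ->]]; split; apply: ideal_sum => // p /sP[Ip Jp].
  by case: Ii => _ _ _ Ir; apply: Ir.
by case: Ji => _ _ Jl _; apply: Jl.
Qed.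

Lemma hact_sum (T : Type) (s : seq T) (F : T -> A) (h : H) :
  hact h (\sum_(p <- s) F p) = \sum_(p <- s) hact h (F p).
Proof. by apply: (big_morph (hact h)); [exact: hactDr | exact: hact0r]. Qed.

Lemma ideal_prod_stable I J : is_ideal I -> is_ideal J ->
  h_stable I -> h_stable J -> h_stable (ideal_prod I J).
Proof.
move=> Ii Ji Is Js h x [s [sP ->]]; rewrite hact_sum.
have IJ := ideal_prod_ideal Ii Ji.
apply: ideal_sum => // p /sP[Ip Jp]; rewrite hactM; apply: ideal_sw => // u v.
by apply: ideal_prod_mem; [apply: Is | apply: Js].
Qed.

Lemma FH_prod I J : FH I -> FH J -> FH (ideal_prod I J).
Proof.
move=> [Ii Is Il Ir] [Ji Js Jl Jr]; split.
- exact: ideal_prod_ideal.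
- exact: ideal_prod_stable.
- move=> x h; apply: Il => y Iy; apply: Jl => z Jz.
  by rewrite -mulrA; apply: h; apply: ideal_prod_mem.
- move=> x h; apply: Jr => z Jz; apply: Ir => y Iy.
  by rewrite mulrA; apply: h; apply: ideal_prod_mem.
Qed.

Lemma FH_cap I J : FH I -> FH J -> FH (I `&` J)%classic.
Proof.
move=> FI FJ; have [Pi Ps Pl Pr] := FH_prod FI FJ.
case: FI FJ => [Ii Is _ _] [Ji Js _ _].
have sub y : ideal_prod I J y -> (I `&` J)%classic y by exact: ideal_prod_sub.
split.
- case: (Ii) (Ji) => [I0 ID Il Ir] [J0 JD Jl Jr]; split=> //.
  + by move=> x y [? ?] [? ?]; split; [apply: ID | apply: JD].
  + by move=> a x [? ?]; split; [apply: Il | apply: Jl].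
  + by move=> a x [? ?]; split; [apply: Ir | apply: Jr].
- by move=> h x [? ?]; split; [apply: Is | apply: Js].
- by move=> x h; apply: Pl => y /sub; apply: h.
- by move=> x h; apply: Pr => y /sub; apply: h.
Qed.

Lemma FH_setT : FH setT.
Proof.
by split=> //; move=> x h; [rewrite -[x]mulr1|rewrite -[x]mul1r]; apply: h.
Qed.

End Ideals.

(* A right linear map I -> A with I in FH; only the values of qfun on qdom
   are meaningful. *)
Record qmap (R : comPzRingType) (H : hopfAlg R) (A : hmodAlg H) := QMap {
  qdom : set A;
  qfun :> A -> A;
  qdomP : FH qdom;
  qfunP : right_linear_on qdom qfun }.

Section Martindale.
Variables (R : comPzRingType) (H : hopfAlg R) (A : hmodAlg H).
Local Notation qmap := (qmap A).
Implicit Types (f g k : qmap) (x y a : A) (h : H).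

HB.instance Definition _ := gen_eqMixin qmap.
HB.instance Definition _ := gen_choiceMixin qmap.

Definition qeq f g : Prop := exists K : set A,
  [/\ FH K, forall x, K x -> qdom f x /\ qdom g x & forall x, K x -> f x = g x].

Lemma qdom_ideal f : is_ideal (qdom f). Proof. by case: (qdomP f). Qed.
Lemma qdom_r f x a : qdom f x -> qdom f (x * a).
Proof. by case: (qdom_ideal f) => _ _ _ Ir; apply: Ir. Qed.
Lemma qdom_l f x a : qdom f x -> qdom f (a * x).
Proof. by case: (qdom_ideal f) => _ _ Il _; apply: Il. Qed.
Lemma qdom_add f x y : qdom f x -> qdom f y -> qdom f (x + y).
Proof. by case: (qdom_ideal f) => _ ID _ _; apply: ID. Qed.
Lemma qdom_act f x h : qdom f x -> qdom f (hact h x).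
Proof. by case: (qdomP f) => _ Is _ _; apply: Is. Qed.
Lemma qdom0 f : qdom f 0. Proof. by case: (qdom_ideal f). Qed.
Lemma qdomZ f r x : qdom f x -> qdom f (r *: x).
Proof. exact: idealZ (qdom_ideal f). Qed.
Lemma qfunD f x y : qdom f x -> qdom f y -> f (x + y) = f x + f y.
Proof. by case: (qfunP f) => fD _; apply: fD. Qed.
Lemma qfunM f x a : qdom f x -> f (x * a) = f x * a.
Proof. by case: (qfunP f) => _ fM; apply: fM. Qed.
Lemma qfun0 f : f 0 = 0.
Proof. by rewrite -(mul0r 0) qfunM ?mulr0 //; apply: qdom0. Qed.
Lemma qfunZ f r x : qdom f x -> f (r *: x) = r *: f x.
Proof.
by move=> fx; rewrite -[x]mulr1 pzscalerAr qfunM // -pzscalerAr !mulr1.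
Qed.

Lemma qfun_sum f (T : eqType) (s : seq T) (F : T -> A) :
  (forall p, p \in s -> qdom f (F p)) ->
  f (\sum_(p <- s) F p) = \sum_(p <- s) f (F p).
Proof.
elim: s => [|p s IH] h; first by rewrite !big_nil qfun0.
have hs q : q \in s -> qdom f (F q) by move=> qs; apply: h; rewrite inE qs orbT.
rewrite !big_cons qfunD ?IH //; first by apply: h; rewrite inE eqxx.
exact: ideal_sum (qdom_ideal f) hs.
Qed.

Lemma qfun_sw f h (F : H -> H -> A) : (forall u v, qdom f (F u v)) ->
  f (sw h F) = sw h (fun u v => f (F u v)).
Proof. by move=> FI; rewrite /sw /tsum qfun_sum. Qed.

Lemma qeq_on f g x : qeq f g -> qdom f x -> qdom g x -> f x = g x.
Proof.
move=> [K [[Ki _ Kl _] Ksub Keq]] fx gx; apply/eqP; rewrite -subr_eq0; apply/eqP.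
apply: Kl => y Ky; rewrite mulrBl -!qfunM // Keq ?subrr //.
by case: Ki => _ _ Kil _; apply: Kil.
Qed.

Lemma qeqP f g : qeq f g <-> (forall x, qdom f x -> qdom g x -> f x = g x).
Proof.
split=> [fg x|fg]; first exact: qeq_on.
exists (qdom f `&` qdom g)%classic; split=> [|x []|x [? ?]] //; last exact: fg.
by apply: FH_cap; apply: qdomP.
Qed.

Definition qeqb f g : bool := `[< qeq f g >].
Lemma qeqb_refl : reflexive qeqb.
Proof. by move=> f; apply/asboolP/qeqP. Qed.
Lemma qeqb_sym : symmetric qeqb.
Proof.
by move=> f g; apply/asboolP/asboolP => -[K [FK sK eK]]; exists K;
  split=> // x Kx; [have [] := sK x Kx | rewrite eK | have [] := sK x Kx
   | rewrite eK].
Qed.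
Lemma qeqb_trans : transitive qeqb.
Proof.
move=> g f k /asboolP fg /asboolP gk; apply/asboolP.
have [[K [FK sK eK]] [L [FL sL eL]]] := (fg, gk).
exists (K `&` L)%classic; split=> [|x [Kx Lx]|x [Kx Lx]]; first exact: FH_cap.
  by split; [case: (sK x Kx) | case: (sL x Lx)].
by rewrite eK ?eL.
Qed.
Canonical qeq_equiv := EquivRel qeqb qeqb_refl qeqb_sym qeqb_trans.

Definition Q0_type := {eq_quot qeq_equiv}.
HB.instance Definition _ := Choice.on Q0_type.
HB.instance Definition _ := EqQuotient.on Q0_type.

Definition qcl f : Q0_type := \pi_Q0_type f.

Lemma qclP f g : qcl f = qcl g <-> qeq f g.
Proof.
split=> [/eqmodP|fg]; last by apply/eqmodP/asboolP.
by rewrite /= /qeqb => /asboolP.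
Qed.

Lemma qclE f g : (forall x, qdom f x -> qdom g x -> f x = g x) -> qcl f = qcl g.
Proof. by move=> fg; apply/qclP/qeqP. Qed.

Lemma qcl_on f g x : qcl f = qcl g -> qdom f x -> qdom g x -> f x = g x.
Proof. by move=> /qclP /qeqP; apply. Qed.

Lemma qcl_repr q : qcl (repr q) = q. Proof. exact: reprK. Qed.
Lemma Q0P q : exists f, q = qcl f. Proof. by exists (repr q); rewrite qcl_repr. Qed.

Lemma qadd_subproof f g :
  right_linear_on (qdom f `&` qdom g)%classic (fun x => f x + g x).
Proof.
split=> [x y [fx gx] [fy gy]|x a [fx gx]]; first by rewrite !qfunD // addrACA.
by rewrite !qfunM // mulrDl.
Qed.
Definition qadd f g := QMap (FH_cap (qdomP f) (qdomP g)) (qadd_subproof f g).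

Lemma qzero_subproof : right_linear_on (setT : set A) (fun=> 0).
Proof. by split=> *; rewrite ?addr0 ?mul0r. Qed.
Definition qzero := QMap (FH_setT A) qzero_subproof.

Lemma qone_subproof : right_linear_on (setT : set A) id.
Proof. by []. Qed.
Definition qone := QMap (FH_setT A) qone_subproof.

Lemma qscale_subproof r f : right_linear_on (qdom f) (fun x => r *: f x).
Proof.
by split=> [x y fx fy|x a fx]; rewrite ?qfunD ?qfunM // ?scalerDr ?pzscalerAl.
Qed.
Definition qscale r f := QMap (qdomP f) (qscale_subproof r f).

Lemma qmul_dom (I : set A) g x : is_ideal I -> ideal_prod (qdom g) I x ->
  qdom g x /\ I (g x).
Proof.
move=> Ii gx; split; first by case: (ideal_prod_sub (qdom_ideal g) Ii gx).
case: gx => s [sP ->]; rewrite qfun_sum; last first.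
  by move=> p /sP[gp _]; apply: qdom_r.
apply: ideal_sum => // p /sP[gp Ip]; rewrite qfunM //.
by case: Ii => _ _ Il _; apply: Il.
Qed.

(* For f : I -> A and g : J -> A the composite f g is defined on J I. *)
Lemma qmul_subproof f g :
  right_linear_on (ideal_prod (qdom g) (qdom f)) (fun x => f (g x)).
Proof.
have D := qmul_dom (qdom_ideal f) (g := g).
split=> [x y /D[gx fx] /D[gy fy]|x a /D[gx fx]]; first by rewrite !qfunD.
by rewrite !qfunM.
Qed.
Definition qmul f g := QMap (FH_prod (qdomP g) (qdomP f)) (qmul_subproof f g).

Lemma qmul_domE f g x : qdom (qmul f g) x -> qdom g x /\ qdom f (g x).
Proof. exact: qmul_dom (qdom_ideal f). Qed.

Definition Qadd (q r : Q0_type) : Q0_type := qcl (qadd (repr q) (repr r)).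
Definition Qscale (c : R) (q : Q0_type) : Q0_type := qcl (qscale c (repr q)).
Definition Qopp (q : Q0_type) : Q0_type := Qscale (-1) q.
Definition Qmul (q r : Q0_type) : Q0_type := qcl (qmul (repr q) (repr r)).

Lemma Qadd_cl f g : Qadd (qcl f) (qcl g) = qcl (qadd f g).
Proof.
apply: qclE => x /= [fx gx] [fx' gx'].
by rewrite (qcl_on (qcl_repr (qcl f)) fx fx') (qcl_on (qcl_repr (qcl g)) gx gx').
Qed.
Lemma Qscale_cl c f : Qscale c (qcl f) = qcl (qscale c f).
Proof.
by apply: qclE => x /= fx fx'; rewrite (qcl_on (qcl_repr (qcl f)) fx fx').
Qed.
Lemma Qmul_cl f g : Qmul (qcl f) (qcl g) = qcl (qmul f g).
Proof.
apply: qclE => x /qmul_domE [gx fx] /qmul_domE [gx' fx'] /=.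
have E := qcl_on (qcl_repr (qcl g)) gx gx'; rewrite E in fx *.
exact: qcl_on (qcl_repr (qcl f)) fx fx'.
Qed.

Ltac Qelim := repeat (let q := fresh "q" in move=> q; case: (Q0P q) => ? {q}->).

Lemma QaddA : associative Qadd.
Proof. by Qelim; rewrite !Qadd_cl; apply: qclE => x /= _ _; rewrite addrA. Qed.
Lemma QaddC : commutative Qadd.
Proof. by Qelim; rewrite !Qadd_cl; apply: qclE => x /= _ _; rewrite addrC. Qed.
Lemma Qadd0 : left_id (qcl qzero) Qadd.
Proof. by Qelim; rewrite !Qadd_cl; apply: qclE => x /= _ _; rewrite add0r. Qed.
Lemma QaddN : left_inverse (qcl qzero) Qopp Qadd.
Proof.
Qelim; rewrite /Qopp Qscale_cl Qadd_cl; apply: qclE => x /= _ _.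
by rewrite scaleN1r addNr.
Qed.
HB.instance Definition _ := GRing.isZmodule.Build Q0_type QaddA QaddC Qadd0 QaddN.

Lemma QmulA : associative Qmul.
Proof. by Qelim; rewrite !Qmul_cl; apply: qclE. Qed.
Lemma Qmul1 : left_id (qcl qone) Qmul.
Proof. by Qelim; rewrite !Qmul_cl; apply: qclE. Qed.
Lemma Qmulr1 : right_id (qcl qone) Qmul.
Proof. by Qelim; rewrite !Qmul_cl; apply: qclE. Qed.
Lemma QmulDl : left_distributive Qmul Qadd.
Proof. by Qelim; rewrite !(Qmul_cl, Qadd_cl); apply: qclE. Qed.
Lemma QmulDr : right_distributive Qmul Qadd.
Proof.
Qelim; rewrite !(Qmul_cl, Qadd_cl); apply: qclE => x _ [].
by move=> /qmul_domE[_ ?] /qmul_domE[_ ?] /=; rewrite qfunD.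
Qed.
HB.instance Definition _ :=
  GRing.Zmodule_isPzRing.Build Q0_type QmulA Qmul1 Qmulr1 QmulDl QmulDr.

Lemma QscaleA c d q : Qscale c (Qscale d q) = Qscale (c * d) q.
Proof.
by move: q; Qelim; rewrite !Qscale_cl; apply: qclE => x /= _ _; rewrite scalerA.
Qed.
Lemma Qscale1 : left_id 1 Qscale.
Proof. by Qelim; rewrite Qscale_cl; apply: qclE => x /= _ _; rewrite scale1r. Qed.
Lemma QscaleDr : right_distributive Qscale +%R.
Proof.
move=> c; Qelim; rewrite -![_ + _]/(Qadd _ _) !(Qscale_cl, Qadd_cl).
by apply: qclE => x /= _ _; rewrite scalerDr.
Qed.
Lemma QscaleDl q : {morph Qscale^~ q : c d / c + d}.
Proof.
move: q; Qelim => c d; rewrite -[RHS]/(Qadd _ _) !(Qscale_cl, Qadd_cl).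
by apply: qclE => x /= _ _; rewrite scalerDl.
Qed.
HB.instance Definition _ := GRing.Zmodule_isLmodule.Build R Q0_type
  QscaleA Qscale1 QscaleDr QscaleDl.

Lemma QscaleAl (c : R) (q r : Q0_type) : c *: (q * r) = (c *: q) * r.
Proof.
move: q r; Qelim; rewrite -[LHS]/(Qscale _ (Qmul _ _)).
by rewrite -[RHS]/(Qmul (Qscale _ _) _) !(Qscale_cl, Qmul_cl); apply: qclE.
Qed.
Lemma QscaleAr (c : R) (q r : Q0_type) : c *: (q * r) = q * (c *: r).
Proof.
move: q r; Qelim; rewrite -[LHS]/(Qscale _ (Qmul _ _)).
rewrite -[RHS]/(Qmul _ (Qscale _ _)) !(Qscale_cl, Qmul_cl).
by apply: qclE => x /qmul_domE[_ fx] _ /=; rewrite qfunZ.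
Qed.
Definition Q0_alg : pzAlg R := @PzAlg R Q0_type Qscale
  QscaleA Qscale1 QscaleDr QscaleDl QscaleAl QscaleAr.

Definition act_fun h (f : A -> A) : A -> A :=
  fun x => sw h (fun h1 h2 => hact h1 (f (hact (antipode h2) x))).

Lemma qlin f (M : lmodType R) (k : M -> A) : (forall m, qdom f (k m)) ->
  linear k -> linear (fun m => f (k m)).
Proof. by move=> fk kl c x y; rewrite kl qfunD ?qfunZ //; apply: qdomZ. Qed.

Lemma act_bilin f x : qdom f x ->
  bilinear_map (fun h1 h2 => hact h1 (f (hact (antipode h2) x))).
Proof.
move=> fx; split=> h; first by lin_solve.
by apply: lin_actr; apply: qlin; [move=> m; apply: qdom_act | lin_solve].
Qed.

Lemma qact_subproof h f : right_linear_on (qdom f) (act_fun h f).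
Proof.
split=> [x y fx fy|x a fx]; rewrite /act_fun.
  rewrite -sw_add; apply: sw_eq => u v.
  by rewrite hactDr qfunD ?hactDr //; apply: qdom_act.
transitivity (sw h (fun u v => sw v (fun v1 v2 => sw u (fun u1 u2 =>
    hact u1 (f (hact (antipode v2) x)) * hact (u2 * antipode v1) a)))).
  apply: sw_eq => u v; rewrite antipode_hactM qfun_sw; last first.
    by move=> v1 v2; apply: qdom_r; apply: qdom_act.
  rewrite (sw_morph (k := hact u)) ?hact0r //; last exact: hactDr.
  apply: sw_eq => v1 v2; rewrite qfunM; last exact: qdom_act.
  by rewrite hactM; apply: sw_eq => ? ?; rewrite hactA.
have qa h' m : linear (fun v2 => hact h' (f (hact (antipode v2) x)) * m).
  by apply: lin_mulr; apply: (act_bilin fx).2.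
rewrite -(swA h (f := fun u v1 v2 => sw u (fun u1 u2 =>
    hact u1 (f (hact (antipode v2) x)) * hact (u2 * antipode v1) a))); last first.
  by split=> ? ?; [lin_solve|lin_solve|apply: lin_swr].
rewrite -sw_mulr; apply: sw_eq => c v2.
rewrite (swA c (f := fun u1 u2 v1 =>
    hact u1 (f (hact (antipode v2) x)) * hact (u2 * antipode v1) a)); last lin_solve.
transitivity (sw c (fun p q =>
    counit q *: (hact p (f (hact (antipode v2) x)) * a))).
  apply: sw_eq => p q; rewrite sw_mull pzscalerAr; congr (_ * _).
  have := antipoder q => /(congr1 (fun z => hact z a)).
  rewrite /= (tsum_linP _ _ (k := fun z : H => hact z a)); last lin_solve.
  by rewrite hactZl hact1 => <-.
rewrite (swr c (k := fun p => hact p (f (hact (antipode v2) x)) * a)) //.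
lin_solve.
Qed.
Definition qact h f := QMap (qdomP f) (qact_subproof h f).

Definition Qact h (q : Q0_type) : Q0_type := qcl (qact h (repr q)).

Lemma Qact_cl h f : Qact h (qcl f) = qcl (qact h f).
Proof.
apply: qclE => x /= fx fx'; apply: sw_eq => u v; congr (hact _ _).
by apply: qcl_on (qcl_repr (qcl f)) _ _; apply: qdom_act.
Qed.

Lemma Qact_bilinear : bilinear_map Qact.
Proof.
split.
  Qelim => c g h; rewrite -[RHS]/(Qadd (Qscale _ _) _).
  rewrite !(Qact_cl, Qscale_cl, Qadd_cl); apply: qclE => x /= fx _.
  exact: sw_linear (act_bilin fx) c g h.
move=> h c; Qelim; rewrite -[RHS]/(Qadd (Qscale _ _) _) -[X in Qact h X]/(Qadd (Qscale _ _) _).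
rewrite !(Qact_cl, Qscale_cl, Qadd_cl); apply: qclE => x /= _ _.
rewrite /act_fun -sw_scale -sw_add; apply: sw_eq => u v.
by rewrite hactDr hactZr.
Qed.

Lemma Qact1 q : Qact 1 q = q.
Proof.
move: q; Qelim; rewrite Qact_cl; apply: qclE => x /= fx _.
by rewrite /act_fun (sw1 (act_bilin fx)) antipode1 !hact1.
Qed.

Lemma QactA (g h : H) (q : Q0_type) : Qact (g * h) q = Qact g (Qact h q).
Proof.
move: q; Qelim; rewrite !Qact_cl; apply: qclE => x /= fx _.
rewrite /act_fun (swM _ _ (act_bilin fx)); apply: sw_eq => g1 g2.
rewrite (sw_morph (k := hact g1)) ?hact0r //; last exact: hactDr.
by apply: sw_eq => h1 h2; rewrite antipodeM !hactA.
Qed.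

Lemma Qact_one h : Qact h 1 = counit h *: (1 : Q0_type).
Proof.
rewrite -[1]/(qcl qone) -[RHS]/(Qscale _ _) Qact_cl Qscale_cl.
apply: qclE => x /= _ _; rewrite /act_fun.
have := antipoder h => /(congr1 (fun z => hact z x)).
rewrite /= (tsum_linP _ _ (k := fun z : H => hact z x)); last lin_solve.
by rewrite hactZl hact1 => <-; apply: sw_eq => u v; rewrite hactA.
Qed.

Lemma qcl_sum (T : Type) (s : seq T) (F : T -> qmap) (I : set A) : FH I ->
  (forall p x, I x -> qdom (F p) x) ->
  exists2 k : qmap, \sum_(p <- s) qcl (F p) = qcl k &
    (forall x, I x -> qdom k x) /\ (forall x, k x = \sum_(p <- s) F p x).
Proof.
move=> FI FI'; elim: s => [|p s [k E [kI kE]]].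
  by exists qzero; rewrite ?big_nil //; split=> // x; rewrite big_nil.
exists (qadd (F p) k); first by rewrite big_cons E -[LHS]/(Qadd _ _) Qadd_cl.
split=> [x Ix|x]; first by split; [apply: FI' | apply: kI].
by rewrite /= kE big_cons.
Qed.

Lemma QactM h q r :
  Qact h (q * r) = sw h (fun h1 h2 => Qact h1 q * Qact h2 r).
Proof.
case: (Q0P q) (Q0P r) => f -> [g ->].
rewrite -[_ * _]/(Qmul _ _) Qmul_cl Qact_cl.
pose F p := qmul (qact p.1 f) (qact p.2 g).
have [|//|k E [kI kE]] := @qcl_sum _ (repr (comul h)) F (qdom (qmul f g)) .
  exact: qdomP.
transitivity (qcl k); last first.
  by rewrite -E /sw /tsum; apply: eq_bigr => p _; rewrite !Qact_cl [RHS]Qmul_cl.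
apply: qclE => x /= fgx _; rewrite kE {E k kI kE}.
rewrite -[RHS]/(sw h (fun p1 p2 => act_fun p1 f (act_fun p2 g x))) /act_fun.
have [gx _] := qmul_domE fgx.
have fgS u : qdom f (g (hact (antipode u) x)).
  by apply: (qmul_domE _).2; apply: qdom_act.
have gS u : qdom g (hact (antipode u) x) by apply: qdom_act.
pose G b w := f (hact b (g (hact (antipode w) x))).
have Gb b : linear (G b).
  apply: qlin; first by move=> w; apply: qdom_act.
  by apply: lin_actr; apply: qlin => //; lin_solve.
have Ga w : linear (G^~ w).
  by apply: qlin; [move=> b; apply: qdom_act | lin_solve].
transitivity (sw h (fun p1 p2 => sw p1 (fun (a b : H) => sw p2 (fun c w =>
   hact a (G (antipode b * c) w))))); last first.
  apply: sw_eq => p1 p2; apply: sw_eq => a b.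
  rewrite (sw_morph (k := hact (antipode b))) ?hact0r //; last exact: hactDr.
  rewrite qfun_sw; last by move=> u v; do 2!apply: qdom_act.
  rewrite (sw_morph (k := hact a)) ?hact0r //; last exact: hactDr.
  by apply: sw_eq => c w; rewrite /G !hactA.
rewrite (swA h (f := fun (a b p2 : H) => sw p2 (fun c w =>
   hact a (G (antipode b * c) w)))); last first.
  split=> u v.
  - by apply: lin_swr => ? ?; lin_solve.
  - apply: lin_swr => ? ?; apply: lin_actr.
    by apply: (lin_comp (k := G^~ _)) (Ga _) _; lin_solve.
  - apply: sw_linear; split=> ?; apply: lin_actr => //.
    by apply: (lin_comp (k := G^~ _)) (Ga _) _; lin_solve.
apply: sw_eq => a d.
rewrite -(swA d (f := fun b c w => hact a (G (antipode b * c) w))); last first.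
  split=> u v; apply: lin_actr; last exact: Gb.
    by apply: (lin_comp (k := G^~ _)) (Ga _) _; lin_solve.
  by apply: (lin_comp (k := G^~ _)) (Ga _) _; exact: mul_lin_l.
transitivity (sw d (fun p q => counit p *: hact a (G 1 q))).
  rewrite (swl d (k := fun q => hact a (G 1 q))); last exact: lin_actr (Gb 1).
  by rewrite /G hact1.
apply: sw_eq => p w; rewrite -hactZr -(linZ _ _ (Ga _)) -antipodel.
rewrite (tsum_linP _ _ (Ga w)) -/(sw p _).
by rewrite (sw_morph (k := hact a)) ?hact0r //; exact: hactDr.
Qed.

Definition Q0 : hmodAlg H := @HModAlg R H Q0_alg Qact
  Qact_bilinear Qact1 QactA QactM Qact_one.

End Martindale.

Arguments Q0 {R H} A.
Arguments qcl {R H A} f.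

Section Endomorphisms.
Variables (S : pzRingType) (M : lmodType S).

Definition lin_pred : {pred M -> M} := fun f => `[< linear f >].

Lemma lin_pred_zmod : zmod_closed lin_pred.
Proof.
split; first by apply/asboolP => a x y; rewrite /GRing.zero /= scaler0 addr0.
move=> f g /asboolP fl /asboolP gl; apply/asboolP => a x y.
rewrite -[LHS]/(f _ - g _) fl gl.
rewrite -[X in _ = _ *: X + _]/(f x - g x) -[X in _ = _ + X]/(f y - g y).
by rewrite scalerBr opprD addrACA.
Qed.

Record lendo := LEndo { lendo_fun :> M -> M; _ : lendo_fun \in lin_pred }.
HB.instance Definition _ := [isSub for lendo_fun].
HB.instance Definition _ := [Choice of lendo by <:].
HB.instance Definition _ := 
  GRing.SubChoice_isSubZmodule.Build (M -> M) lin_pred lendo lin_pred_zmod.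

Lemma lendo_linear (f : lendo) : linear f.
Proof. by have /asboolP := valP f. Qed.

Definition mk_lendo (f : M -> M) (fl : linear f) : lendo := LEndo (asboolT fl).

Definition lendo_one : lendo := @mk_lendo id (fun a x y => erefl).
Lemma lendo_mul_subproof (f g : lendo) : linear (fun x => f (g x)).
Proof. by move=> a x y; rewrite !lendo_linear. Qed.
Definition lendo_mul (f g : lendo) : lendo := mk_lendo (lendo_mul_subproof f g).

Lemma lendo_mulA : associative lendo_mul.
Proof. by move=> f g h; apply: val_inj. Qed.
Lemma lendo_mul1 : left_id lendo_one lendo_mul.
Proof. by move=> f; apply: val_inj. Qed.
Lemma lendo_mulr1 : right_id lendo_one lendo_mul.
Proof. by move=> f; apply: val_inj. Qed.
Lemma lendo_mulDl : left_distributive lendo_mul +%R.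
Proof. by move=> f g h; apply: val_inj. Qed.
Lemma lendo_mulDr : right_distributive lendo_mul +%R.
Proof.
move=> f g h; apply: val_inj; apply/funext => x /=.
by have := lendo_linear f 1 (g x) (h x); rewrite !scale1r.
Qed.
HB.instance Definition _ := GRing.Zmodule_isPzRing.Build lendo
  lendo_mulA lendo_mul1 lendo_mulr1 lendo_mulDl lendo_mulDr.

End Endomorphisms.

Definition injective_module (S : pzRingType) (E : lmodType S) : Prop :=
  forall (X Y : lmodType S) (j : {linear X -> Y}) (f : {linear X -> E}),
    injective j -> exists g : {linear Y -> E}, forall x, g (j x) = f x.

Definition essential_mono (S : pzRingType) (M E : lmodType S)
    (i : {linear M -> E}) : Prop :=
  injective i /\
  forall N : {pred E}, submod_closed N ->
    (forall m, i m \in N -> m = 0) -> forall x, x \in N -> x = 0.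

Definition injective_hull (S : pzRingType) (M E : lmodType S)
    (i : {linear M -> E}) : Prop :=
  injective_module E /\ essential_mono i.

(* The sum of the images of all homomorphisms M -> E. *)
Section Trace.
Variables (S : pzRingType) (M E : lmodType S).

Definition trace : {pred E} := fun x => `[< exists s : seq ({linear M -> E} * M),
  x = \sum_(p <- s) p.1 p.2 >].

Lemma trace_submod : submod_closed trace.
Proof.
split; first by apply/asboolP; exists [::]; rewrite big_nil.
move=> a x y /asboolP[s ->] /asboolP[t ->]; apply/asboolP.
exists ([seq (p.1, a *: p.2) | p <- s] ++ t); rewrite big_cat big_map /=.
rewrite scaler_sumr; congr (_ + _); apply: eq_bigr => p _; exact/esym/linearZ.
Qed.
HB.instance Definition _ := GRing.isSubmodClosed.Build S E trace trace_submod.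

End Trace.

Arguments trace {S} M E.

(* If i : M -> E is an injective hull, then self_hull M E is the self-injective
   hull of M, and self_hull_in i is the inclusion of M in it. *)
Section SelfInjectiveHull.
Variables (S : pzRingType) (M E : lmodType S) (i : {linear M -> E}).

Record self_hull := SelfHull { self_hull_val :> E; _ : self_hull_val \in trace M E }.
HB.instance Definition _ := [isSub for self_hull_val].
HB.instance Definition _ := [Choice of self_hull by <:].
HB.instance Definition _ := [SubChoice_isSubLmodule of self_hull by <:].

Lemma self_hull_in_subproof m : i m \in trace M E.
Proof. by apply/asboolP; exists [:: (i, m)]; rewrite big_seq1. Qed.
Definition self_hull_in (m : M) : self_hull := SelfHull (self_hull_in_subproof m).
End SelfInjectiveHull.

Arguments self_hull {S} M E.

Section MultiplicationRing.
Variables (R : comPzRingType) (H : hopfAlg R) (A : hmodAlg H).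

Definition lmul_endo (a : A) : lendo A := mk_lendo (mul_lin_l a).
Definition rmul_endo (a : A) : lendo A := mk_lendo (mul_lin_r a).
Definition hact_endo (h : H) : lendo A :=
  mk_lendo ((hact_bilinear A).2 h).

(* Membership in every subring of the endomorphism ring of the R-module A
   containing the L_a, the R_a and the L_h. *)
Definition MH_pred : {pred lendo A} := fun phi => `[< forall P : {pred lendo A},
  subring_closed P -> (forall a, lmul_endo a \in P) ->
  (forall a, rmul_endo a \in P) -> (forall h, hact_endo h \in P) -> phi \in P >].

Lemma MH_subring : subring_closed MH_pred.
Proof.
split.
- by apply/asboolP => P [].
- move=> f g /asboolP hf /asboolP hg; apply/asboolP => P sP Pl Pr Ph.
  by case: (sP) => _ PB _; apply: PB; [apply: hf | apply: hg].
- move=> f g /asboolP hf /asboolP hg; apply/asboolP => P sP Pl Pr Ph.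
  by case: (sP) => _ _ PM; apply: PM; [apply: hf | apply: hg].
Qed.

Record MH := MHElt { MH_val :> lendo A; _ : MH_val \in MH_pred }.
HB.instance Definition _ := [isSub for MH_val].
HB.instance Definition _ := [Choice of MH by <:].
HB.instance Definition _ := 
  GRing.SubChoice_isSubPzRing.Build (lendo A) MH_pred MH MH_subring.

Definition MHmod : Type := A.
HB.instance Definition _ := GRing.Zmodule.on MHmod.

Definition MH_scale (phi : MH) (x : MHmod) : MHmod := MH_val phi x.
Lemma MH_scaleA phi psi x : MH_scale phi (MH_scale psi x) = MH_scale (phi * psi) x.
Proof. by []. Qed.
Lemma MH_scale1 : left_id 1 MH_scale. Proof. by []. Qed.
Lemma MH_scaleDr : right_distributive MH_scale +%R.
Proof. by move=> phi x y; apply: (linD _ _ (lendo_linear (MH_val phi))). Qed.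
Lemma MH_scaleDl x : {morph MH_scale^~ x : phi psi / phi + psi}.
Proof. by []. Qed.
HB.instance Definition _ := GRing.Zmodule_isLmodule.Build MH MHmod
  MH_scaleA MH_scale1 MH_scaleDr MH_scaleDl.

End MultiplicationRing.

Arguments MH {R H} A.
Arguments MHmod {R H} A.

Definition von_neumann_regular (C : pzRingType) : Prop :=
  forall x : C, exists y : C, x = x * y * x.

Definition self_injective_ring (C : pzRingType) : Prop := injective_module C^o.

(* The largest domain on which f restricts to a map into A: f^-1(A) meet A. *)
Definition restriction_dom (R : comPzRingType) (H : hopfAlg R) (A : hmodAlg H)
    (E : lmodType (MH A)) (i : {linear MHmod A -> E})
    (f : lendo (self_hull (MHmod A) E)) : set A :=
  fun a => exists b : A, f (self_hull_in i a) = self_hull_in i b.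

(* Main.v *)
Require Import Defs.
From HB Require Import structures.
From mathcomp Require Import all_boot all_order all_algebra.
From mathcomp Require Import all_classical.
Import GRing.Theory.
Local Open Scope ring_scope.

(* In an H-semiprime algebra satisfying one of the three hypotheses, the right
   annihilator of an H-stable ideal I lies in the left one, which is H-stable
   and meets I trivially. Hence F_H consists of the essential M_H(A)-submodules
   of A, and an M_H(A)-linear map defined on an H-stable ideal N extends by zero
   to N + Ann N, which is in F_H. The classes of such maps are exactly the
   elements of Z(Q_0)^H, because centrality amounts to left linearity and
   invariance to H-linearity.

   Regularity of Z(Q_0)^H: if p has kernel K, a quasi-inverse of [p] is the
   extension of the inverse of p restricted to Ann K. Self-injectivity: by
   Baer's criterion it is enough to realise a linear phi : J -> Z(Q_0)^H as a
   multiplication, and sum c_k x_k |-> sum phi(c_k) x_k does it; it is well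
   defined because phi is a multiplication on finitely generated ideals.

   For psi, the essential extension A <= E makes I_f essential. If f vanishes on
   I_f then f = 0, since each x in the hull satisfies x K <= I_f for some K in
   F_H. Surjectivity extends p : I -> A <= E to an endomorphism of E, which
   preserves the trace of A. *)

(** * Annihilators of H-stable ideals *)

Section Annihilators.
Set Implicit Arguments.
Unset Strict Implicit.
Variables (R : comPzRingType) (H : hopfAlg R) (A : hmodAlg H).
Implicit Types (I J : set A) (a b x y : A) (h : H).

(** Expanding the right side gives [h1 a] times [h2 S(h3) b], which collapses by coassociativity and
    the antipode axiom. It moves the action off the left factor, so that left annihilators are
    H-stable. *)
Lemma hact_mull h a b :
  hact h a * b = sw h (fun u v => hact u (a * hact (antipode v) b)).
Proof.
transitivity (sw h (fun u v => sw u (fun u1 u2 =>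
    hact u1 a * hact (u2 * antipode v) b))); last first.
  by apply: sw_eq => u v; rewrite hactM; apply: sw_eq => ? ?; rewrite hactA.
rewrite (swA h (f := fun u1 u2 v => hact u1 a * hact (u2 * antipode v) b));
  last lin_solve.
rewrite -[LHS](swr h (k := fun u => hact u a * b)); last lin_solve.
apply: sw_eq => u v; rewrite sw_mull pzscalerAr; congr (_ * _).
have := antipoder v => /(congr1 (fun z => hact z b)).
rewrite /= (tsum_linP _ _ (k := fun z : H => hact z b)); last lin_solve.
by rewrite hactZl hact1 => <-.
Qed.

(** The mirror image of [hact_mull], with the inverse [T] of the antipode in its place; it serves
    right annihilators. *)
Lemma hact_mulr (T : H -> H) h a b :
  cancel (@antipode R H) T -> cancel T (@antipode R H) ->
  a * hact h b = sw h (fun u v => hact v (hact (T u) a * b)).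
Proof.
move=> ST TS.
have Tl : linear T.
  by move=> k x y; apply: (can_inj ST); rewrite antipode_linear !TS.
(* The antipode is injective and antimultiplicative, and it sends [v * T u] to [u * antipode v]. *)
have TE k : sw k (fun u v => v * T u) = counit k *: (1 : H).
  apply: (can_inj ST); rewrite [LHS](tsum_linP _ _ (@antipode_linear R H)).
  rewrite (linZ _ _ (@antipode_linear R H)) antipode1 -antipoder.
  by apply: tsum_eq => u v; rewrite antipodeM TS.
transitivity (sw h (fun u v => sw v (fun v1 v2 =>
    hact (v1 * T u) a * hact v2 b))); last first.
  by apply: sw_eq => u v; rewrite hactM; apply: sw_eq => ? ?; rewrite hactA.
rewrite -(swA h (f := fun u v1 v2 => hact (v1 * T u) a * hact v2 b)); last first.
  split=> ? ?; [|lin_solve|lin_solve].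
  by apply/lin_mulr/lin_actl/lin_mull.
rewrite -[LHS](swl h (k := fun v => a * hact v b)); last lin_solve.
apply: sw_eq => u v; rewrite sw_mulr pzscalerAl; congr (_ * _).
have := TE u => /(congr1 (fun z => hact z a)).
rewrite /sw (tsum_linP _ _ (k := fun z : H => hact z a)); last lin_solve.
by rewrite hactZl hact1 => <-.
Qed.

Definition lann I : set A := fun x => forall y, I y -> x * y = 0.
Definition rann I : set A := fun x => forall y, I y -> y * x = 0.

Lemma lann_ideal I : is_ideal I -> is_ideal (lann I).
Proof.
move=> [_ _ Il _]; split=> [y _|x z Lx Lz y Iy|a x Lx y Iy|a x Lx y Iy].
- by rewrite mul0r.
- by rewrite mulrDl Lx ?Lz ?addr0.
- by rewrite -mulrA Lx ?mulr0.
- by rewrite -mulrA Lx //; apply: Il.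
Qed.

Lemma rann_ideal I : is_ideal I -> is_ideal (rann I).
Proof.
move=> [_ _ _ Ir]; split=> [y _|x z Lx Lz y Iy|a x Lx y Iy|a x Lx y Iy].
- by rewrite mulr0.
- by rewrite mulrDr Lx ?Lz ?addr0.
- by rewrite mulrA Lx //; apply: Ir.
- by rewrite mulrA Lx ?mul0r.
Qed.

Lemma sw0 h : sw h (fun _ _ => 0 : A) = 0.
Proof. by rewrite /sw /tsum big1. Qed.

Lemma lann_stable I : h_stable I -> h_stable (lann I).
Proof.
move=> Is h x Lx y Iy; rewrite hact_mull -(sw0 h); apply: sw_eq => u v.
by rewrite Lx ?hact0r //; apply: Is.
Qed.

Lemma rann_stable I : bijective (@antipode R H) -> h_stable I ->
  h_stable (rann I).
Proof.
move=> [T ST TS] Is h x Rx y Iy; rewrite (hact_mulr _ _ _ ST TS) -(sw0 h).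
by apply: sw_eq => u v; rewrite Rx ?hact0r //; apply: Is.
Qed.

Lemma square_zero_nilpotent I : (forall x y, I x -> I y -> x * y = 0) ->
  is_ideal I -> nilpotent_ideal I.
Proof.
(* The zeroth power is the whole algebra, so the exponent 2 stands for [I (I A)], whose inner factor
   lies in [I]. *)
move=> I2 Ii; exists 2 => x [s [sP ->]]; rewrite big_seq big1 // => p /sP[Ip].
have Ti : is_ideal (setT : set A) by split.
by case/(ideal_prod_sub Ii Ti) => Jp _; apply: I2.
Qed.

(** The product of [rann I] and [I] squares to zero, because [I] times [rann I] is zero. It vanishes
    by semiprimeness, or by H-semiprimeness once a bijective antipode makes [rann I] stable. All
    three alternatives on A and H enter the proof here. *)
Lemma rann_sub_lann I :
  h_semiprime A ->
  [\/ commutative (@GRing.mul A), semiprime A | bijective (@antipode R H)] ->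
  is_ideal I -> h_stable I -> forall x, rann I x -> lann I x.
Proof.
move=> hA hyp Ii Is x Rx y Iy; have Ri := rann_ideal Ii.
have RIi := ideal_prod_ideal Ri Ii.
have RIn : nilpotent_ideal (ideal_prod (rann I) I).
  apply: square_zero_nilpotent => // u v.
  move=> /(ideal_prod_sub Ri Ii)[_ Iu] /(ideal_prod_sub Ri Ii)[Rv _].
  exact: Rv.
case: hyp => [mC|sA|bS]; first by rewrite mC; apply: Rx.
  by apply: (sA _ RIi) => //; apply: ideal_prod_mem.
apply: (hA _ RIi) => //; last exact: ideal_prod_mem.
by apply: ideal_prod_stable => //; apply: rann_stable.
Qed.

(** The intersection is an H-stable ideal of square zero. *)
Lemma lann_cap I x : h_semiprime A -> is_ideal I -> h_stable I ->
  lann I x -> I x -> x = 0.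
Proof.
move=> hA Ii Is Lx Ix; have Li := lann_ideal Ii.
case: (Ii) (Li) => [I0 ID Il Ir] [L0 LD Ll Lr].
have LIi : is_ideal (lann I `&` I)%classic.
  by split=> [|u v [? ?] [? ?]|a u [? ?]|a u [? ?]]; split; auto.
apply: (hA _ LIi) => //.
  by move=> h u [Lu Iu]; split; [apply: lann_stable | apply: Is].
by apply: square_zero_nilpotent => // u v [Lu _] [_ Iv]; apply: Lu.
Qed.

End Annihilators.

(** * Essential H-stable ideals and the linear maps defined on them *)

Section Graphs.
Set Implicit Arguments.
Unset Strict Implicit.
Variables (R : comPzRingType) (H : hopfAlg R) (A : hmodAlg H).
Hypothesis hA : h_semiprime A.
Hypothesis rann_lann : forall I : set A, is_ideal I -> h_stable I ->
  forall x, rann I x -> lann I x.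
Implicit Types (I J : set A) (p : qmap A) (a b x y : A) (h : H).

(** The left annihilator meets [I] trivially, so essentiality makes it zero, and the right
    annihilator lies inside it. *)
Lemma FH_essential I : is_ideal I -> h_stable I ->
  (forall J, is_ideal J -> h_stable J -> (forall x, I x -> J x -> x = 0) ->
     forall x, J x -> x = 0) -> FH I.
Proof.
move=> Ii Is ess; have L0 x : lann I x -> x = 0.
  apply: ess; [exact: lann_ideal | exact: lann_stable |].
  by move=> y Iy Ly; apply: lann_cap Ly Iy.
by split=> // x Rx; apply: L0; apply: rann_lann.
Qed.

(** Right linearity and additivity are already carried by [qmap]; with these two clauses [p] is
    M_H(A)-linear. *)
Definition mh_linear p : Prop :=
  (forall a x, qdom p x -> p (a * x) = a * p x) /\
  (forall h x, qdom p x -> p (hact h x) = hact h (p x)).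

(** For x in [qdom g] and y in [qdom p], both g(p(xy)) and p(g(xy)) equal g(x)p(y), so the maps
    agree on sums of such products. Invariance is the antipode axiom applied to p(x). *)
Lemma mh_linear_center_inv p : mh_linear p -> qcl p \in @center_inv R H (Q0 A).
Proof.
move=> [pl ph]; apply/asboolP; split=> [c|h].
  case: (Q0P c) => g ->; rewrite -[LHS]/(Qmul _ _) -[RHS]/(Qmul _ _) !Qmul_cl.
  have [gi pi] := (qdom_ideal g, qdom_ideal p).
  apply: qclE => x /= [s [sP ->]] _.
  have gt t : t \in s -> qdom g (t.1 * t.2) by case/sP=> gt _; apply: qdom_r.
  have pt t : t \in s -> qdom p (t.1 * t.2) by case/sP=> _ pt; apply: qdom_l.
  have gpt t : t \in s -> g (p (t.1 * t.2)) = p (g (t.1 * t.2)).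
    by case/sP=> gt1 pt2; rewrite pl // !(@qfunM _ _ _ g) // pl.
  rewrite (qfun_sum gt) (qfun_sum pt) !qfun_sum => [|t /sP[gt1 pt2]|t /sP[gt1 pt2]].
  - by apply: eq_big_seq => t /gpt.
  - by rewrite pl //; apply: qdom_r.
  - by rewrite qfunM //; apply: qdom_l.
rewrite -[LHS]/(Qact _ _) -[RHS]/(Qscale _ _) Qact_cl Qscale_cl.
apply: qclE => x /= px _; rewrite /act_fun.
transitivity (sw h (fun u v => hact (u * antipode v) (p x))).
  by apply: sw_eq => u v; rewrite ph // hactA.
have := antipoder h => /(congr1 (fun z => hact z (p x))).
rewrite (tsum_linP _ _ (k := fun z : H => hact z (p x))); last lin_solve.
by rewrite hactZl hact1 => <-.
Qed.

(** Commuting with the class of left multiplication by a gives left linearity. Invariance gives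
    H-linearity: p(hx) is the sum of h1 p(S(h2) h3 x), which is h p(x). *)
Lemma center_inv_mh_linear p : qcl p \in @center_inv R H (Q0 A) -> mh_linear p.
Proof.
move=> /asboolP[pc pinv]; have pi := qdom_ideal p.
have phl x : qdom p x -> forall h, act_fun h p x = counit h *: p x.
  move=> px h; have := pinv h.
  rewrite -[LHS]/(Qact _ _) -[RHS]/(Qscale _ _) Qact_cl Qscale_cl => E.
  exact: (qcl_on E).
split=> [a x px|h x px].
  have la : right_linear_on (setT : set A) ( *%R a).
    by split=> *; rewrite ?mulrDr ?mulrA.
  have := pc (qcl (QMap (FH_setT A) la)).
  rewrite -[LHS]/(Qmul _ _) -[RHS]/(Qmul _ _) !Qmul_cl => E.
  apply: (qcl_on (x := x) E) => /=.
    by rewrite -[x]mul1r; apply: ideal_prod_mem.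
  by rewrite -[x]mulr1; apply: ideal_prod_mem.
have dpx (u : H) : qdom p (hact u x) by apply: qdom_act.
have pxl : linear (fun u : H => p (hact u x)) by apply: qlin => //; lin_solve.
transitivity (sw h (fun u v => sw u (fun u1 u2 =>
    hact u1 (p (hact (antipode u2 * v) x))))).
  rewrite -(swl h (k := fun u => p (hact u x))) //.
  apply: sw_eq => u v; rewrite -(phl _ (dpx v)).
  by apply: sw_eq => u1 u2; rewrite hactA.
rewrite (swA h (f := fun u1 u2 v => hact u1 (p (hact (antipode u2 * v) x))));
  last first.
  split=> ? ?; first lin_solve.
    by apply/lin_actr/(lin_comp (k := fun u => p (hact u x))) => //; lin_solve.
  by apply/lin_actr/(lin_comp (k := fun u => p (hact u x))) => //; lin_solve.
rewrite -[RHS](swr h (k := fun u => hact u (p x))); last lin_solve.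
apply: sw_eq => u v.
rewrite -(sw_morph (k := hact u)) ?hact0r //; last exact: hactDr.
rewrite -hactZr; congr (hact u _).
rewrite -[in RHS](hact1 (x)) -(linZ _ _ pxl) -antipodel.
by rewrite (tsum_linP _ _ pxl).
Qed.

Lemma mh_linear_repr (c : center_inv_ring (Q0 A)) :
  mh_linear (repr (center_inv_val c)).
Proof. by apply: center_inv_mh_linear; rewrite qcl_repr; apply: valP. Qed.

(* Graphs of M_H(A)-linear maps from an H-stable ideal to A. For a nonempty
   additive G, single-valuedness is the last clause, and G 0 0 is automatic. *)
Definition mh_graph (G : A -> A -> Prop) : Prop :=
  [/\ forall x y x' y', G x y -> G x' y' -> G (x + x') (y + y'),
      forall a x y, G x y -> G (a * x) (a * y),
      forall a x y, G x y -> G (x * a) (y * a),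
      forall h x y, G x y -> G (hact h x) (hact h y)
    & forall y, G 0 y -> y = 0].

Lemma mh_graph_uniq G x y y' : mh_graph G -> G x y -> G x y' -> y = y'.
Proof.
move=> [GD Gl _ _ G0] Gy Gy'; apply/eqP; rewrite -subr_eq0; apply/eqP/G0.
by rewrite -(subrr x) -[- x]mulN1r -[- y']mulN1r; apply: GD => //; apply: Gl.
Qed.

Lemma mh_graph_dom G x0 y0 : mh_graph G -> G x0 y0 ->
  is_ideal (fun x => exists y, G x y) /\ h_stable (fun x => exists y, G x y).
Proof.
move=> [GD Gl Gr Gh G0] G00; split; last first.
  by move=> h x [y Gy]; exists (hact h y); apply: Gh.
split.
- by exists 0; have := Gl 0 _ _ G00; rewrite !mul0r.
- by move=> x x' [y Gy] [y' Gy']; exists (y + y'); apply: GD.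
- by move=> a x [y Gy]; exists (a * y); apply: Gl.
- by move=> a x [y Gy]; exists (y * a); apply: Gr.
Qed.

Lemma mh_graph_qmap G : mh_graph G -> FH (fun x => exists y, G x y) ->
  exists p : qmap A, [/\ qdom p = (fun x => exists y, G x y),
    forall x, qdom p x -> G x (p x) & mh_linear p].
Proof.
move=> Gg GF; have [GD Gl Gr Gh G0] := Gg.
pose f x := xget 0 (G x).
have fP x : (exists y, G x y) -> G x (f x).
  by case=> y Gy; rewrite /f; case: xgetP => [z //|/(_ y)].
have fE x y : G x y -> f x = y.
  by move=> Gy; apply: (mh_graph_uniq Gg (fP _ (ex_intro _ y Gy)) Gy).
have fR : right_linear_on (fun x => exists y, G x y) f.
  split=> [x x' /fP Gx /fP Gx'|x a /fP Gx]; apply: fE.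
    exact: GD.
  exact: Gr.
exists (QMap GF fR); split=> //; split=> [a x|h x] /fP ?; apply: fE.
  exact: Gl.
exact: Gh.
Qed.

(** [G'] is the extension by zero along the left annihilator of the domain [N]. *)
Lemma mh_graph_extend G x0 y0 : mh_graph G -> G x0 y0 ->
  exists2 p : qmap A, mh_linear p & forall x y, G x y -> qdom p x /\ p x = y.
Proof.
move=> Gg G00; have [Ni Ns] := mh_graph_dom Gg G00.
have [GD Gl Gr Gh G0] := Gg.
set N := (fun x => _) in Ni Ns.
have Li := lann_ideal Ni; have Ls := lann_stable Ns.
have [[N0 _ _ _] [L0 LD Ll Lr]] := (Ni, Li).
pose G' v y := exists2 x, G x y & lann N (v - x).
have GG' x y : G x y -> G' x y by exists x; rewrite ?subrr.
have G'g : mh_graph G'.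
  split.
  - move=> v y v' y' [x Gx Lx] [x' Gx' Lx']; exists (x + x'); first exact: GD.
    by rewrite opprD addrACA; apply: LD.
  - move=> a v y [x Gx Lx]; exists (a * x); first exact: Gl.
    by rewrite -mulrBr; apply: Ll.
  - move=> a v y [x Gx Lx]; exists (x * a); first exact: Gr.
    by rewrite -mulrBl; apply: Lr.
  - move=> h v y [x Gx Lx]; exists (hact h x); first exact: Gh.
    by rewrite -scaleN1r -hactZr scaleN1r -hactDr; apply: Ls.
  - move=> y [x Gx]; rewrite sub0r => Lx; apply: G0.
    suff <- : x = 0 by [].
    apply: (lann_cap hA Ni Ns); last by exists y.
    by rewrite -[x]opprK -mulN1r; apply: Ll.
have [G'i G's] := mh_graph_dom G'g (GG' _ _ G00).
have G'F : FH (fun x => exists y, G' x y).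
  (* If J meets the new domain trivially, then J N, which lies in both J and N, is zero; hence J is
     inside [lann N], a part of that domain. *)
  apply: FH_essential => // J Ji Js J0 x Jx; apply: (J0 x) => //.
  exists 0, 0; first by have := Gl 0 _ _ G00; rewrite !mul0r.
  rewrite subr0 => z Nz; apply: J0; last by case: (Ji) => _ _ _; apply.
  have [_ _ Nl _] := Ni; have [y Gy] := Nl x z Nz.
  by exists y; apply: GG'.
have [p [pd pG pl]] := mh_graph_qmap G'g G'F.
exists p => // x y Gxy; have px : qdom p x by rewrite pd; exists y; apply: GG'.
by split=> //; apply: mh_graph_uniq G'g (pG _ px) (GG' _ _ Gxy).
Qed.

(** * Regularity of Z(Q_0)^H and homomorphisms from its ideals *)

Local Notation C := (center_inv_ring (Q0 A)).

Lemma center_invM (c : C) p q : center_inv_val c = qcl p ->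
  forall d : C, center_inv_val d = qcl q -> center_inv_val (c * d) = qcl (qmul p q).
Proof. by move=> cp d dq; rewrite -Qmul_cl -cp -dq. Qed.

Lemma center_inv_mulC : commutative (@GRing.mul C).
Proof.
move=> c d; apply: val_inj; have /asboolP[cc _] := valP c; exact: cc.
Qed.

Lemma center_inv_regular : von_neumann_regular C.
Proof.
move=> c; pose p := repr (center_inv_val c).
have cp : center_inv_val c = qcl p by rewrite qcl_repr.
have [pl ph] : mh_linear p := mh_linear_repr c.
pose K : set A := fun x => qdom p x /\ p x = 0.
have [d0 dD dl dr] := qdom_ideal p.
have Ki : is_ideal K.
  split.
  - by split=> //; apply: qfun0.
  - by move=> x y [px x0] [py y0]; split; [apply: dD | rewrite qfunD // x0 y0 addr0].
  - by move=> a x [px x0]; split; [apply: dl | rewrite pl // x0 mulr0].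
  - by move=> a x [px x0]; split; [apply: dr | rewrite qfunM // x0 mul0r].
have Ks : h_stable K.
  by move=> h x [px x0]; split; [apply: qdom_act | rewrite ph // x0 hact0r].
have [L0 LD Ll Lr] := lann_ideal Ki; have Ls := lann_stable Ks.
(* The transposed graph of p restricted to [lann K]; it is single-valued because [lann K] meets the
   kernel trivially. *)
pose G y x := [/\ qdom p x, lann K x & y = p x].
have Gg : mh_graph G.
  split.
  - move=> y x y' x' [px Lx ->] [px' Lx' ->].
    by split; [apply: dD | apply: LD | rewrite qfunD].
  - by move=> a y x [px Lx ->]; split; [apply: dl | apply: Ll | rewrite pl].
  - by move=> a y x [px Lx ->]; split; [apply: dr | apply: Lr | rewrite qfunM].
  - by move=> h y x [px Lx ->]; split; [apply: qdom_act | apply: Ls | rewrite ph].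
  - by move=> x [px Lx p0]; apply: (lann_cap hA Ki Ks).
have G00 : G 0 0 by split=> //; rewrite qfun0.
have [q ql qG] := mh_graph_extend Gg G00.
pose d : C := CenterInv (mh_linear_center_inv ql).
exists d; apply: val_inj.
have dq : center_inv_val d = qcl q by [].
rewrite [RHS](center_invM (center_invM cp dq) cp) [LHS]cp.
(* The two maps agree on [K + (dom p n Ann K)], which is essential. *)
pose D : set A := fun v => exists x y, [/\ K x, qdom p y, lann K y & v = x + y].
have DF : FH D.
  have Di : is_ideal D.
    have [K0 KD Kl Kr] := Ki.
    split.
    - by exists 0, 0; rewrite addr0; split.
    - move=> _ _ [x [y [Kx py Ly ->]]] [x' [y' [Kx' py' Ly' ->]]].
      by exists (x + x'), (y + y'); rewrite addrACA; split; auto.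
    - move=> a _ [x [y [Kx py Ly ->]]].
      by exists (a * x), (a * y); rewrite mulrDr; split; auto.
    - move=> a _ [x [y [Kx py Ly ->]]].
      by exists (x * a), (y * a); rewrite mulrDl; split; auto.
  apply: FH_essential => //.
    move=> h _ [x [y [Kx py Ly ->]]]; exists (hact h x), (hact h y).
    by rewrite hactDr; split; [apply: Ks| apply: qdom_act | apply: Ls|].
  (* If J meets D trivially, then J K is zero, so J times [qdom p] lies in [lann K] and in [qdom p],
     hence in D, and is zero too; [qdom p] has zero left annihilator. *)
  move=> J [_ _ Jl Jr] Js J0 x Jx; have [_ _ dF _] := qdomP p.
  have Kdom y : K y -> D y by exists y, 0; rewrite addr0; split.
  have LKx : lann K x.
    move=> y Ky; apply: J0; last exact: Jr.
    by apply: Kdom; case: Ki => _ _ Kl _; apply: Kl.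
  apply: dF => y py; apply: J0; last exact: Jr.
  by exists 0, (x * y); rewrite add0r; split; auto; case: Ki.
apply/qclP; exists (D `&` qdom (qmul (qmul p q) p))%classic; split.
- exact/FH_cap/qdomP.
- by move=> x [[u [v [[pu _] pv _ ->]]] E]; split=> //; apply: dD.
- move=> _ [[x [y [[px x0] py Ly ->]]] _] /=.
  rewrite [in RHS]qfunD // x0 add0r.
  have [_ ->] := qG (p y) y (And3 py Ly erefl).
  by rewrite qfunD // x0 add0r.
Qed.

(** By regularity each c generates the same ideal as an idempotent e, so a multiplier for the
    earlier elements can be corrected on e alone. *)
Lemma regular_hom_on_seq (J : {pred C}) (phi : C -> C) (s : seq C) :
  (forall a b : C, b \in J -> a * b \in J) ->
  (forall a b : C, b \in J -> phi (a * b) = a * phi b) ->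
  (forall c, c \in s -> c \in J) ->
  exists u, forall c, c \in s -> phi c = c * u.
Proof.
move=> JM phiM; elim: s => [|c s IH] sJ; first by exists 0.
have [|u uP] := IH; first by move=> d ds; apply: sJ; rewrite inE ds orbT.
have cJ : c \in J by apply: sJ; rewrite inE eqxx.
have [d cdc] := center_inv_regular c.
pose e := d * c; have eJ : e \in J by apply: JM.
have ce : c * e = c by rewrite mulrA -cdc.
have ee : e * e = e by rewrite /e -mulrA [c * _]mulrA -cdc.
clearbody e.
(* On c this gives c phi(e) = phi(c). An earlier b sees no change, since b phi(e) = phi(be) = e b
   u. *)
exists (u + e * (phi e - u)) => b; rewrite inE => /orP[/eqP ->|bs].
  rewrite mulrDr mulrA ce mulrBr addrCA subrr addr0.
  by rewrite -phiM // ce.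
have bJ : b \in J by apply: sJ; rewrite inE bs orbT.
rewrite uP // mulrDr.
suff -> : b * (e * (phi e - u)) = 0 by rewrite addr0.
rewrite !mulrBr -[e * phi e]phiM // ee.
have -> : b * phi e = e * (b * u).
  by rewrite -phiM // center_inv_mulC phiM // uP // inE bs orbT.
by rewrite !mulrA [e * b]center_inv_mulC subrr.
Qed.

Lemma center_inv_ideal_hom (J : {pred C}) (phi : C -> C) :
  (0 \in J) ->
  (forall a b : C, b \in J -> a * b \in J) ->
  (forall a b : C, b \in J -> phi (a * b) = a * phi b) ->
  exists u, forall c, c \in J -> phi c = c * u.
Proof.
move=> J0 JM phiM.
pose P (c : C) := repr (center_inv_val c).
have PE c : center_inv_val c = qcl (P c) by rewrite qcl_repr.
have Pl c : mh_linear (P c) := mh_linear_repr c.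
pose ok (t : C * A) := [/\ t.1 \in J, qdom (P t.1) t.2 & qdom (P (phi t.1)) t.2].
pose G x y := exists s : seq (C * A), [/\ forall t, t \in s -> ok t,
  x = \sum_(t <- s) P t.1 t.2 & y = \sum_(t <- s) P (phi t.1) t.2].
(* One closure argument for left multiplications, right multiplications and the action of H. *)
have Gmap (k : A -> A) x y : {morph k : x y / x + y} -> k 0 = 0 ->
    (forall p z, mh_linear p -> qdom p z -> qdom p (k z) /\ p (k z) = k (p z)) ->
    G x y -> G (k x) (k y).
  move=> kD k0 kP [s [sP -> ->]]; exists [seq (t.1, k t.2) | t <- s]; split.
  - move=> _ /mapP[t /sP[Jt pt rt] ->]; split=> //=.
      by case: (kP _ _ (Pl t.1) pt).
    by case: (kP _ _ (Pl (phi t.1)) rt).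
  - rewrite big_map (big_morph k kD k0); apply: eq_big_seq => t /sP[Jt pt rt].
    by case: (kP _ _ (Pl t.1) pt) => _ ->.
  - rewrite big_map (big_morph k kD k0); apply: eq_big_seq => t /sP[Jt pt rt].
    by case: (kP _ _ (Pl (phi t.1)) rt) => _ ->.
have Gg : mh_graph G.
  split.
  - move=> _ _ _ _ [s [sP -> ->]] [t [tP -> ->]]; exists (s ++ t).
    split; rewrite ?big_cat // => v.
    by rewrite mem_cat => /orP[/sP|/tP].
  - move=> a x y; apply: Gmap; [exact: mulrDr | exact: mulr0 |].
    by move=> p z [pl _] pz; split; [apply: qdom_l | apply: pl].
  - move=> a x y; apply: (Gmap (fun z => z * a)) => [? ?||p z _ pz].
    + exact: mulrDl.
    + exact: mul0r.
    + by split; [apply: qdom_r | apply: qfunM].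
  - move=> h x y; apply: Gmap; [exact: hactDr | exact: hact0r |].
    by move=> p z [_ ph] pz; split; [apply: qdom_act | apply: ph].
  (* A multiplier u for the finitely many coefficients turns the value, times any z in the domain of
     u, into u applied to (sum of c_t x_t) z, which is 0; that domain has zero left annihilator. *)
  - move=> y [s [sP x0 ->]].
    have [|u uP] := regular_hom_on_seq (s := [seq t.1 | t <- s]) JM phiM.
      by move=> _ /mapP[t /sP[Jt _ _] ->].
    have [_ _ Fl _] := qdomP (P u); apply: Fl => z uz.
    rewrite mulr_suml.
    transitivity (\sum_(t <- s) P u (P t.1 t.2 * z)).
      apply: eq_big_seq => t ts; have [_ pt rt] := sP t ts.
      rewrite -!qfunM //.
      have E : qcl (P (phi t.1)) = qcl (qmul (P u) (P t.1)).
        rewrite -PE uP; last exact: map_f.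
        by rewrite center_inv_mulC; apply: center_invM.
      apply: (qcl_on (x := t.2 * z) E); first exact: qdom_r.
      exact: ideal_prod_mem.
    rewrite -qfun_sum; last by move=> t ts; apply: qdom_l.
    by rewrite -mulr_suml -x0 mul0r qfun0.
have G00 : G 0 0 by exists [::]; rewrite !big_nil; split.
have [q ql qG] := mh_graph_extend Gg G00.
pose u : C := CenterInv (mh_linear_center_inv ql).
exists u => c cJ; apply: val_inj; rewrite center_inv_mulC.
have uq : center_inv_val u = qcl q by [].
rewrite [RHS](center_invM uq (PE c)) [LHS]PE.
apply: qclE => x rx /qmul_domE[px _] /=.
have /qG [_ ->] : G (P c x) (P (phi c) x) => //.
by exists [:: (c, x)]; rewrite !big_seq1; split=> // t; rewrite inE => /eqP ->.
Qed.

End Graphs.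

(** * Submodules as modules in their own right *)

Section Submodules.
Set Implicit Arguments.
Unset Strict Implicit.
Variables (S : pzRingType) (M : lmodType S) (N : submodClosed M).

Record submod_type := SubmodElt { submod_val :> M; _ : submod_val \in N }.
HB.instance Definition _ := [isSub for submod_val].
HB.instance Definition _ := [Choice of submod_type by <:].
HB.instance Definition _ := [SubChoice_isSubLmodule of submod_type by <:].

End Submodules.

(** * Baer's criterion *)

Section Baer.
Set Implicit Arguments.
Unset Strict Implicit.
Variable S : pzRingType.

Lemma linear_bundle (M N : lmodType S) (f : M -> N) : linear f ->
  exists g : {linear M -> N}, forall x, g x = f x.
Proof.
move=> fl; pose fL := GRing.isLinear.Build S M N *:%R f fl.
pose g : {linear M -> N} := HB.pack f fL.
by exists g.
Qed.

Variable E : lmodType S.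

(** Zorn's lemma on graphs of partial linear maps from Y to E that extend f along j. Only the values
    of [phi] on [J] matter. *)
Lemma baer_criterion :
  (forall (J : {pred S}) (phi : S -> E), 0 \in J ->
     (forall a b c, b \in J -> c \in J -> a * b + c \in J) ->
     (forall a b c, b \in J -> c \in J -> phi (a * b + c) = a *: phi b + phi c) ->
     exists e, forall c, c \in J -> phi c = c *: e) ->
  injective_module E.
Proof.
move=> baer X Y j f ji.
pose sub (G : set (Y * E)) := G (0, 0) /\
  forall a u v, G u -> G v -> G (a *: u.1 + v.1, a *: u.2 + v.2).
pose functional (G : set (Y * E)) := forall e, G (0, e) -> e = 0.
pose base : set (Y * E) := fun u => exists x, u = (j x, f x).
pose good G := [/\ sub G, functional G & forall u, base u -> G u].
have goodb : good base.
  split=> //; last first.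
    by move=> e [x [/esym jx ->]]; rewrite (ji x 0) ?linear0.
  split; first by exists 0; rewrite !linear0.
  by move=> a _ _ [x ->] [x' ->]; exists (a *: x + x'); rewrite !linearP.
pose P G := G = set0 \/ good G.
have [] := @Zorn_bigcup _ P.
  move=> F FP Ftot.
  have [[G0 FG0 gG0]|nF] := pselect (exists2 G, F G & good G); last first.
    left; apply/seteqP; split=> // u [G FG Gu]; case: (FP _ FG) => [G0|gG].
      by rewrite G0 in Gu.
    by case: nF; exists G.
  right; split; last by move=> u bu; exists G0 => //; case: gG0 => _ _; apply.
    split; first by exists G0 => //; case: gG0 => [[]].
    move=> a u v [G FG Gu] [G' FG' Gv].
    have [GG'|G'G] := Ftot _ _ FG FG'.
      exists G' => //; case: (FP _ FG') => [G'0|[[_ Gl] _ _]].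
        by rewrite G'0 in Gv.
      by apply: Gl => //; apply: GG'.
    exists G => //; case: (FP _ FG) => [G'0|[[_ Gl] _ _]].
      by rewrite G'0 in Gu.
    by apply: Gl => //; apply: G'G.
  move=> e [G FG Ge]; case: (FP _ FG) => [G'0|[_ Gf _]]; last exact: Gf.
  by rewrite G'0 in Ge.
move=> G [PG Gmax].
have [[G00 Gl] Gf Gb] : good G.
  case: PG => // G0; case: (Gmax base); last by right.
  rewrite G0; split=> // /(_ (j 0, f 0)) []; by exists 0.
have GD u v : G u -> G v -> G (u.1 + v.1, u.2 + v.2).
  by move=> Gu Gv; have := Gl 1 _ _ Gu Gv; rewrite !scale1r.
have GZ a u : G u -> G (a *: u.1, a *: u.2).
  by move=> Gu; have := Gl a _ _ Gu G00; rewrite !addr0.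
have Guniq y e e' : G (y, e) -> G (y, e') -> e = e'.
  move=> Ge Ge'; apply/eqP; rewrite -subr_eq0; apply/eqP/Gf.
  have := Gl (-1) _ _ Ge' Ge; rewrite /= !scaleN1r addNr.
  by rewrite addrC.
have Gtot y : exists e, G (y, e).
  (* The left ideal of scalars that bring y into the domain of G; [e0] will be a value for y
     compatible with all of them. *)
  pose J : {pred S} := fun c => `[< exists e, G (c *: y, e) >].
  pose phi c := xget 0 (fun e => G (c *: y, e)).
  have phiP c : c \in J -> G (c *: y, phi c) by move=> /asboolP /xgetPex; apply.
  have [||a b c Jb Jc|e0 phiE] := baer J phi.
  - by apply/asboolP; exists 0; rewrite scale0r.
  - move=> a b c /asboolP[e Ge] /asboolP[e' Ge']; apply/asboolP.
    by exists (a *: e + e'); rewrite scalerDl -scalerA; apply: (Gl _ _ _ Ge Ge').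
  - apply: (Guniq ((a * b + c) *: y)).
      apply: (phiP); apply/asboolP; exists (a *: phi b + phi c).
      rewrite scalerDl -scalerA; exact: (Gl _ _ _ (phiP _ Jb) (phiP _ Jc)).
    rewrite scalerDl -scalerA; exact: (Gl _ _ _ (phiP _ Jb) (phiP _ Jc)).
  exists e0; apply: contrapT => nG.
  pose G' : set (Y * E) := fun v => exists c u, G u /\
    v = (c *: y + u.1, c *: e0 + u.2).
  have GG' u : G u -> G' u.
    by move=> Gu; exists 0, u; rewrite !scale0r !add0r -surjective_pairing.
  case: (Gmax G'); last first.
    right; split; last by move=> u /Gb /GG'.
      split; first exact: GG'.
      move=> a _ _ [c [u [Gu ->]]] [c' [u' [Gu' ->]]] /=.
      exists (a * c + c'), (a *: u.1 + u'.1, a *: u.2 + u'.2).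
      split; first exact: Gl.
      by rewrite /= !scalerDl -!scalerA !scalerDr !addrA; congr (_, _);
        rewrite -!addrA; congr (_ + _); rewrite addrCA.
    move=> e [c [[u1 u2] [Gu [/esym /eqP]]]] /=.
    rewrite addr_eq0 => /eqP yu ->.
    have Gc : G (c *: y, - u2).
      by rewrite yu -!scaleN1r; apply: (GZ _ _ Gu).
    have cJ : c \in J by apply/asboolP; exists (- u2).
    by rewrite -phiE // (Guniq _ _ _ (phiP _ cJ) Gc) addNr.
  split=> // /(_ (y, e0)) G'G; apply/nG/G'G.
  by exists 1, (0, 0); rewrite !scale1r !addr0.
pose g y := xget 0 (fun e => G (y, e)).
have gP y : G (y, g y) by case: (Gtot y) => e; apply: (@xgetI _ 0 (fun e => G (y, e))).
have gl : linear g.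
  by move=> a x y; apply: (Guniq _ _ _ (gP _) (Gl a _ _ (gP x) (gP y))).
have [k kE] := linear_bundle gl.
by exists k => x; rewrite kE; apply: (Guniq _ _ _ (gP _)); apply: Gb; exists x.
Qed.

End Baer.

(** * Endomorphisms of the self-injective hull of A and their restrictions to A *)

Section SelfInjectiveHullOfA.
Set Implicit Arguments.
Unset Strict Implicit.
Variables (R : comPzRingType) (H : hopfAlg R) (A : hmodAlg H).
Hypothesis hA : h_semiprime A.
Hypothesis rann_lann : forall I : set A, is_ideal I -> h_stable I ->
  forall x, rann I x -> lann I x.
Implicit Types (I J : set A) (p q : qmap A) (a b x y : A) (h : H).

Lemma MH_lmul_subproof a : lmul_endo a \in @MH_pred R H A.
Proof. by apply/asboolP => P _ Pl _ _; apply: Pl. Qed.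
Definition MH_lmul a : MH A := MHElt (MH_lmul_subproof a).

Lemma MH_rmul_subproof a : rmul_endo a \in @MH_pred R H A.
Proof. by apply/asboolP => P _ _ Pr _; apply: Pr. Qed.
Definition MH_rmul a : MH A := MHElt (MH_rmul_subproof a).

Lemma MH_hact_subproof h : @hact_endo R H A h \in @MH_pred R H A.
Proof. by apply/asboolP => P _ _ _ Ph; apply: Ph. Qed.
Definition MH_hact h : MH A := MHElt (MH_hact_subproof h).

Lemma MH_lmulE a (x : MHmod A) : MH_lmul a *: x = a * (x : A).
Proof. by []. Qed.
Lemma MH_rmulE a (x : MHmod A) : MH_rmul a *: x = (x : A) * a.
Proof. by []. Qed.
Lemma MH_hactE h (x : MHmod A) : MH_hact h *: x = hact h (x : A).
Proof. by []. Qed.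

(** M_H(A) is the least subring containing the generators, so it suffices that the endomorphisms
    preserving [qdom p] and commuting with p form such a subring. *)
Lemma mh_linear_MH p (m : MH A) (x : MHmod A) : mh_linear p -> qdom p x ->
  qdom p (m *: x) /\ p (m *: x) = m *: (p x : MHmod A).
Proof.
move=> [pl ph] px.
pose P : {pred lendo A} := fun phi => `[< forall x, qdom p x ->
  qdom p (phi x) /\ p (phi x) = phi (p x) >].
suff /asboolP/(_ x px) : MH_val m \in P by [].
have /asboolP/(_ P) := valP m; apply.
- split; first by apply/asboolP.
    move=> f g /asboolP fP /asboolP gP; apply/asboolP => y py.
    have [[fy fE] [gy gE]] := (fP y py, gP y py).
    rewrite -[(f - g) y]/(f y - g y) -[(f - g) (p y)]/(f (p y) - g (p y)).
    have ngy : qdom p (- g y) by rewrite -mulN1r; apply: qdom_l.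
    split; first exact: qdom_add.
    by rewrite qfunD // fE -gE -mulN1r pl // mulN1r.
  move=> f g /asboolP fP /asboolP gP; apply/asboolP => y py.
  have [gy gE] := gP y py; have [fy fE] := fP _ gy.
  by split=> //; rewrite -[RHS]/(f (g (p y))) -gE.
- by move=> a; apply/asboolP => y py; split; [apply: qdom_l | apply: pl].
- by move=> a; apply/asboolP => y py; split; [apply: qdom_r | apply: qfunM].
- by move=> h; apply/asboolP => y py; split; [apply: qdom_act | apply: ph].
Qed.

Lemma qdom_submod p : mh_linear p ->
  submod_closed (fun x : MHmod A => `[< qdom p x >]).
Proof.
move=> pl; split; first by apply/asboolP/qdom0.
move=> m x y /asboolP px /asboolP py; apply/asboolP; apply: qdom_add => //.
by case: (mh_linear_MH m pl px).
Qed.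

Variables (E : lmodType (MH A)) (i : {linear MHmod A -> E}).
Hypothesis i_hull : injective_hull i.

Lemma hull_inj : injective i. Proof. by case: i_hull => _ []. Qed.

Lemma stable_ideal_MH J : is_ideal J -> h_stable J ->
  forall (m : MH A) x, J x -> J (m *: (x : MHmod A)).
Proof.
move=> Ji Js m; have [J0 JD Jl Jr] := Ji.
pose P : {pred lendo A} := fun phi => `[< forall x, J x -> J (phi x) >].
suff /asboolP : MH_val m \in P by [].
have /asboolP/(_ P) := valP m; apply.
- split; first by apply/asboolP.
    move=> f' g /asboolP fP /asboolP gP; apply/asboolP => y Jy.
    rewrite -[(f' - g) y]/(f' y - g y) -mulN1r.
    by apply: JD; [apply: fP | apply/Jl/gP].
  by move=> f' g /asboolP fP /asboolP gP; apply/asboolP => y Jy; apply/fP/gP.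
- by move=> a; apply/asboolP => y; apply: Jl.
- by move=> a; apply/asboolP => y; apply: Jr.
- by move=> h; apply/asboolP => y; apply: Js.
Qed.

(** If J meets the preimage trivially, its image under f meets A trivially, so f vanishes on J by
    essentiality of E; then J lies in the preimage and is zero. *)
Lemma FH_preimage (f : {linear MHmod A -> E}) I : FH I ->
  FH (fun a : A => exists2 b, I b & f a = i b).
Proof.
move=> [Ii Is _ IR];
have [I0 ID Il Ir] := Ii.
apply: FH_essential => //.
- split.
  + by exists 0 => //; rewrite !linear0.
  + move=> x y [b Ib fx] [c Ic fy]; exists (b + c); first exact: ID.
    by rewrite !linearD fx fy.
  + move=> a x [b Ib fx]; exists (a * b); first exact: Il.
    by rewrite -!MH_lmulE !linearZ fx.
  + move=> a x [b Ib fx]; exists (b * a); first exact: Ir.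
    by rewrite -!MH_rmulE !linearZ fx.
- move=> h x [b Ib fx]; exists (hact h b); first exact: Is.
  by rewrite -!MH_hactE !linearZ fx.
move=> J Ji Js IJ0 x Jx; have JMH := stable_ideal_MH Ji Js.
have [J0 JD Jl Jr] := Ji.
have f0 y : J y -> f y = 0.
  pose N : {pred E} := fun e => `[< exists2 z, J z & e = f z >].
  case: (i_hull) => _ [_ /(_ N)] ess Jy; apply: ess; last by apply/asboolP; exists y.
    split; first by apply/asboolP; exists 0; rewrite ?linear0.
    move=> m _ _ /asboolP[u Ju ->] /asboolP[v Jv ->]; apply/asboolP.
    exists ((m *: (u : MHmod A) + v) : A); last by rewrite linearP.
    by apply: JD => //; apply: JMH.
  (* With f z = i m and b in I, f(bz) = i(bm) and bm is in I; so bz lies in the preimage and in J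
     and is 0. Thus bm = 0 for all b, and m = 0. *)
  move=> m /asboolP[z Jz mz].
  apply: IR => b Ib; have /IJ0 : J (z * b) by apply: Jr.
  move=> zb0.
  have bm : i (b * m) = f (b * z).
    by rewrite -(MH_lmulE b m) -(MH_lmulE b z) !linearZ mz.
  have bz0 : b * z = 0.
    by apply: IJ0; [exists (b * m); [apply: Ir | rewrite bm] | apply: Jl].
  by apply: hull_inj; rewrite bm bz0 !linear0.
apply: IJ0 => //; exists 0 => //.
by rewrite f0 // linear0.
Qed.

Local Notation Ah := (self_hull (MHmod A) E).
Local Notation T := (lendo Ah).
Local Notation inh := (self_hull_in i).

Lemma hull_lendoD (f : T) u v : f (u + v) = f u + f v.
Proof. by have := lendo_linear f 1 u v; rewrite !scale1r. Qed.
Lemma hull_lendo0 (f : T) : f 0 = 0.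
Proof. by apply: (addIr (f 0)); rewrite -hull_lendoD !add0r. Qed.
Lemma hull_lendoZ (f : T) m u : f (m *: u) = m *: f u.
Proof. by have := lendo_linear f m u 0; rewrite hull_lendo0 !addr0. Qed.

Lemma hull_in_linear : linear inh.
Proof. by move=> m x y; apply: val_inj; rewrite /= linearP. Qed.

Lemma hull_in_inj : injective inh.
Proof. by move=> x y /(congr1 val) /= /hull_inj. Qed.

Lemma restriction_dom_FH (f : T) : FH (restriction_dom i f).
Proof.
have fl : linear (fun a : MHmod A => val (f (inh a))).
  by move=> m x y; rewrite hull_in_linear lendo_linear.
have [g gE] := linear_bundle fl.
suff -> : restriction_dom i f = (fun a : A => exists2 b, setT b & g a = i b).
  exact/FH_preimage/FH_setT.
apply/funext => a; apply/propext; split=> [[b fb]|[b _ fb]]; exists b => //.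
  by rewrite gE fb.
by apply: val_inj; rewrite -gE fb.
Qed.

Definition restricts p (f : T) : Prop :=
  forall a, qdom p a -> inh (p a) = f (inh a).

Lemma restriction_exists (f : T) :
  exists p, [/\ qdom p = restriction_dom i f, restricts p f & mh_linear p].
Proof.
pose G a b := f (inh a) = inh b.
have inl := hull_in_linear.
have inD x y : inh (x + y) = inh x + inh y.
  by have := inl 1 x y; rewrite !scale1r.
have in0 : inh 0 = 0 by apply: (addIr (inh 0)); rewrite -inD !add0r.
have inZ (m : MH A) (x : MHmod A) : inh (m *: x) = m *: inh x.
  by have := inl m x 0; rewrite in0 !addr0.
have GZ (m : MH A) (x y : MHmod A) : G x y -> G (m *: x) (m *: y).
  by rewrite /G !inZ hull_lendoZ => ->.
have Gg : mh_graph G.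
  split; [|by move=> a; apply: (GZ (MH_lmul a))
          |by move=> a; apply: (GZ (MH_rmul a))
          |by move=> a; apply: (GZ (MH_hact a))|].
    by move=> x y x' y' Gx Gx'; rewrite /G !inD hull_lendoD Gx Gx'.
  by move=> y Gy; apply: hull_in_inj; rewrite -Gy in0 hull_lendo0.
have [p [pd pG pl]] := mh_graph_qmap Gg (restriction_dom_FH f).
by exists p; split=> // a /pG ->.
Qed.

Lemma restricts_uniq p q (f : T) :
  restricts p f -> restricts q f -> qcl p = qcl q.
Proof.
by move=> pf qf; apply: qclE => x px qx; apply: hull_in_inj; rewrite pf // qf.
Qed.

Lemma hull_mul_mem I (x : E) : FH I -> x \in trace (MHmod A) E ->
  exists2 K, FH K & forall y, K y -> exists2 b, I b & MH_rmul y *: x = i b.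
Proof.
move=> FI /asboolP[s ->]; have [[I0 ID Il _] _ _ _] := FI.
elim: s => [|[g a] s [K FK IH]].
  by exists setT; [exact: FH_setT | exists 0; rewrite ?big_nil ?scaler0 ?linear0].
exists (K `&` (fun y : A => exists2 b, I b & g y = i b))%classic.
  by apply: FH_cap => //; apply: FH_preimage.
move=> y [Ky [b Ib gy]]; have [c Ic cE] := IH y Ky.
exists (a * b + c); first by apply: ID => //; apply: Il.
rewrite big_cons scalerDr cE linearD /=; congr (_ + _).
have -> : MH_rmul y *: g a = g (MH_lmul a *: (y : MHmod A)).
  by rewrite -linearZ.
by rewrite linearZ gy -linearZ.
Qed.

(** This is the injectivity of psi. If f u = m lies in A, then uy is in [qdom p] for all y in some K
    of F_H, so my = f(uy) = 0 and m = 0. The image of f thus meets A trivially and is zero. *)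
Lemma restricts0 p (f : T) : restricts p f -> qcl p = 0 -> f = 0.
Proof.
move=> pf p0; apply: val_inj; apply/funext => x /=.
have pE a : qdom p a -> f (inh a) = 0.
  move=> pa; have E0 := qcl_on (g := qzero A) p0 pa I.
  rewrite -pf // E0 /=; apply: val_inj; exact: linear0.
pose N : {pred E} := fun e => `[< exists u : Ah, e = val (f u) >].
case: (i_hull) => _ [_ /(_ N)] ess; apply: val_inj.
apply: ess; last by apply/asboolP; exists x.
  split; first by apply/asboolP; exists 0; rewrite hull_lendo0.
  move=> m _ _ /asboolP[u ->] /asboolP[v ->]; apply/asboolP.
  by exists (m *: u + v); rewrite lendo_linear.
move=> m /asboolP[u mu].
have [K [_ _ Kl _] KP] := hull_mul_mem (qdomP p) (valP u).
apply: Kl => y /KP[b pb ub].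
apply: hull_inj; rewrite -(MH_rmulE y m) linearZ mu linear0.
rewrite -[LHS]/(val (MH_rmul y *: f u)) -hull_lendoZ.
have -> : MH_rmul y *: u = inh b by apply: val_inj.
by rewrite pE.
Qed.

(** This is the surjectivity of psi. Injectivity of E extends p to an endomorphism g of E, and g
    preserves the trace because g composed with a map from A to E is again such a map. *)
Lemma hull_endo_extends p : mh_linear p -> exists f : T, restricts p f.
Proof.
move=> pl; pose Nm := GRing.isSubmodClosed.Build _ _ _ (qdom_submod pl).
pose N : submodClosed (MHmod A) := HB.pack (fun x : MHmod A => `[< qdom p x >]) Nm.
have jl : linear (fun x : submod_type N => val x) by [].
have [j jE] := linear_bundle jl.
have fl : linear (fun x : submod_type N => i (p (val x))).
  move=> m x y /=; have /asboolP px := valP x; have /asboolP py := valP y.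
  have [mx mE] := mh_linear_MH m pl px.
  by rewrite qfunD // mE linearP.
have [f fE] := linear_bundle fl.
have ji : injective (i \o j).
  by move=> x y /= /hull_inj; rewrite !jE => /val_inj.
have [g gE] : exists g : {linear E -> E}, forall u, g ((i \o j) u) = f u.
  by case: i_hull => Einj _; apply: Einj.
have gT (x : Ah) : g (val x) \in trace (MHmod A) E.
  have /asboolP[s ->] := valP x; apply/asboolP.
  pose gc (k : {linear MHmod A -> E}) : {linear MHmod A -> E} := g \o k.
  exists [seq (gc t.1, t.2) | t <- s].
  by rewrite big_map linear_sum.
have Fl : linear (fun x : Ah => SelfHull (gT x)).
  by move=> m x y; apply: val_inj; rewrite /= linearP.
exists (mk_lendo Fl) => a pa; apply: val_inj => /=.
pose x := @SubmodElt _ _ N a (asboolT pa).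
by have := gE x; rewrite fE /= jE /= => ->.
Qed.

End SelfInjectiveHullOfA.

Theorem proposition3p4 (R : comPzRingType) (H : hopfAlg R) (A : hmodAlg H)
    (A_H_semiprime : h_semiprime A)
    (A_or_H : [\/ commutative (@GRing.mul A), semiprime A
               | bijective (@antipode R H)]) :
  (forall (E : lmodType (MH A)) (i : {linear MHmod A -> E}),
     injective_hull i ->
     exists psi : {rmorphism lendo (self_hull (MHmod A) E) ->
                             center_inv_ring (Q0 A)},
       bijective psi /\
       forall f, exists p : qmap A,
         [/\ qdom p = restriction_dom i f,
             forall a, restriction_dom i f a ->
               self_hull_in i (p a) = f (self_hull_in i a)
           & center_inv_val (psi f) = qcl p])
  /\ von_neumann_regular (center_inv_ring (Q0 A))
  /\ self_injective_ring (center_inv_ring (Q0 A)).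
Proof.
have rl I (Ii : is_ideal I) (Is : h_stable I) :=
  rann_sub_lann A_H_semiprime A_or_H Ii Is.
split; last first.
  split; first exact: center_inv_regular.
  (* Over the regular module, multiplication by a ring element is exactly what the criterion asks
     for. *)
  apply: baer_criterion => J phi J0 JL phiL.
  have JM (a b : center_inv_ring (Q0 A)) : b \in J -> a * b \in J.
    by move=> Jb; rewrite -[_ * _]addr0; apply: JL.
  have phi0 : phi 0 = 0.
    apply: (addIr (phi 0)); rewrite add0r -[X in X + _](scale1r (phi 0)).
    by rewrite -phiL // mulr0 addr0.
  apply: (center_inv_ideal_hom A_H_semiprime rl J0 JM) => a b Jb.
  by rewrite -[a * b]addr0 phiL // phi0 addr0.
move=> E i i_hull.
have [p pP] := choice (restriction_exists A_H_semiprime rl i_hull).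
have pr f : restricts i (p f) f by case: (pP f).
have pl f : mh_linear (p f) by case: (pP f).
pose psi f := CenterInv (mh_linear_center_inv (pl f)).
(* Any map restricting f represents psi f, so differences and products can be computed on the
   representatives [qadd] and [qmul], whose domains may be smaller. *)
have psiE f q : restricts i q f -> val (psi f) = qcl q.
  by move=> qf; apply: (restricts_uniq i_hull (pr f) qf).
have psiB : zmod_morphism psi.
  move=> f g; apply: val_inj.
  rewrite (psiE _ (qadd (p f) (qscale (-1) (p g)))) => [|a [/= fa ga]].
    by rewrite -Qadd_cl -Qscale_cl.
  rewrite scaleN1r -[RHS]/(f _ - g _) -(pr f) // -(pr g) //.
  by apply: val_inj; rewrite /= linearB.
have psiM : monoid_morphism psi.
  split=> [|f g]; apply: val_inj; first by rewrite (psiE _ (qone A)).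
  rewrite (psiE _ (qmul (p f) (p g))) -?Qmul_cl // => a /qmul_domE[ga fga] /=.
  by rewrite (pr f) // (pr g).
pose psiA := GRing.isZmodMorphism.Build _ _ psi psiB.
pose psi1 := GRing.isMonoidMorphism.Build _ _ psi psiM.
pose Psi : {rmorphism lendo (self_hull (MHmod A) E) -> center_inv_ring (Q0 A)} :=
  HB.pack psi psiA psi1.
exists Psi; split; last first.
  move=> f; exists (p f); have [pd _ _] := pP f; split=> // a.
  by rewrite -pd; apply: pr.
have Psi_inj : injective Psi.
  apply: raddf_inj => f /(congr1 val) /=.
  exact: (restricts0 A_H_semiprime rl i_hull (pr f)).
have Psi_onto (c : center_inv_ring (Q0 A)) : exists f, Psi f = c.
  have [f fr] := hull_endo_extends i_hull (mh_linear_repr c).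
  by exists f; apply: val_inj; rewrite [LHS](psiE _ _ fr) qcl_repr.
have [k kP] := choice Psi_onto.
by exists k => // f; apply: Psi_inj; rewrite kP.
Qed.
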